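(* Let $0<\alpha^*<1$. There exist real numbers $1/2<\sigma_0<1$, $B\ge 4$ and $\nu_0<\infty$ such that the following holds. For all positive integers $\nu\ge \nu_0$, there exist at least $\alpha^*\, 2^{B\nu+1}$ integers $j$ with $1\le j\le 2^{B\nu+1}$ for which $$\zeta(\sigma+it)\neq 0 \qquad \text{for all } \sigma\ge \sigma_0 \text{ and all } t\in \big[\,2^{2B\nu}+(j-1)2^{B\nu-1},\; 2^{2B\nu}+j\,2^{B\nu-1}\big).$$
   Context: $\zeta$ denotes the Riemann zeta function; $\sigma$ and $t$ are real. The intervals $[2^{2B\nu}+(j-1)2^{B\nu-1}, 2^{2B\nu}+j2^{B\nu-1})$ with $1\le j\le 2^{B\nu+1}$ are those of the subdivision of $[2^{2B\nu},2^{2B\nu+1})$ into consecutive intervals of length $2^{B\nu-1}$. *)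

(* Defs.v *)
From Stdlib Require Export Reals ZArith List.
From Coquelicot Require Export Coquelicot.

Open Scope R_scope.

Definition Cexp (z : C) : C :=
  (exp (Re z) * cos (Im z), exp (Re z) * sin (Im z)).

(* [n ^ s = exp (s log n)]; meaningful for [n >= 1] only. *)
Definition nat_Cpower (n : nat) (s : C) : C :=
  Cexp (s * RtoC (ln (INR n)))%C.

(* The Riemann zeta function is the analytic continuation to [C \ {1}] of the
   Dirichlet series [sum_(n >= 1) n ^ (-s)], [Re s > 1].  By the identity
   theorem the two conditions determine [zeta s] for every [s <> 1]; the value
   at the pole [s = 1] is left unspecified.  [ex_derive] is taken over the
   field [C], so it is complex differentiability. *)
Definition is_riemann_zeta (zeta : C -> C) : Prop :=
  (forall s : C, 1 < Re s ->
     is_series (fun n : nat => nat_Cpower (S n) (- s)%C) (zeta s)) /\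
  (forall s : C, s <> RtoC 1 -> ex_derive (K := C_AbsRing) zeta s).

(* [2 ^ x] for a real exponent [x]. *)
Definition two_Rpower (x : R) : R := Rpower 2 x.

Definition subdivision_interval (B : R) (nu : nat) (j : Z) (t : R) : Prop :=
  two_Rpower (2 * B * INR nu) + (IZR j - 1) * two_Rpower (B * INR nu - 1) <= t
  < two_Rpower (2 * B * INR nu) + IZR j * two_Rpower (B * INR nu - 1).

Definition zero_free_index (zeta : C -> C) (sigma0 B : R) (nu : nat) (j : Z)
  : Prop :=
  forall sigma t : R, sigma0 <= sigma -> subdivision_interval B nu j t ->
    zeta ((sigma, t) : C) <> RtoC 0.

(* At least [x] integers satisfy [P]. *)
Definition at_least (x : R) (P : Z -> Prop) : Prop :=
  exists J : list Z, NoDup J /\ (forall j, In j J -> P j) /\ x <= INR (length J).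

(* Main.v *)
(* With B = 4 put W = 4^nu, so that the intervals have length W^2 / 2 and lie at
   height T = W^4, and put N = W^16.  A zero s of zeta at that height with
   Re s >= 63/64 is detected by a Mobius mollifier: sum_(n <= N) n^(-s) is tiny,
   so its product with sum_(n <= N) mu(n) n^(-s), which is
   1 + sum_(N < n <= N^2) a_n n^(-s) with |a_n| <= d(n), is small, and the last
   sum is at least 1/2 in modulus.  By Halasz's duality argument such large
   values at points W^2 / 2 apart number at most W times a power of log T: the
   off-diagonal sums sum_(N < n <= N^2) n^(-w) are evaluated by Euler-Maclaurin,
   since N is much larger than T.  So only o(W^2) of the 2 W^2 intervals are bad.

   The bound on sum_(n <= N) n^(-s) comes from the approximation of zeta by
   sum_(n <= N) n^(-s) + N^(1-s) / (s-1), whose error is controlled directly for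
   Re s > 1.  It is carried over to the left of this line by a maximum principle
   with constant 4, applied to the error times a holomorphic weight which is
   small on the part of a square's boundary where Re s <= 1. *)

Require Import Defs.
From Stdlib Require Import Lra Lia Classical ClassicalEpsilon.
From HB Require Import structures.
From mathcomp Require Import ssreflect.
Open Scope R_scope.

(** * Goursat's theorem and a weak maximum principle *)

(** All that is known of zeta is its series for Re s > 1 and its differentiability away from 1;
    there is no growth bound to the left of the line. Convergence of the approximations to zeta is
    therefore shown there only qualitatively: on a fixed square zeta is bounded by some unknown
    constant, and this constant fixes the weight before the length of the sum is chosen. The
    explicit error comes from comparing the approximations with each other, where zeta does not
    occur, so the unknown constant leaves no trace in it.

    The exponents fit as follows. Since N^2 = W^32 and 2 (1 - 63/64) = 1/32, going left to Re s =
    63/64 costs on the diagonal only a factor (N^2)^(1/32) = W. The error |s| / sqrt N is about W^4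
    / W^8. Off the diagonal the spacing makes the pole terms at most a multiple of W / W^2, and 1 /
    W beats the power of log T coming from the divisor function. Zeros in two neighbouring intervals
    may be arbitrarily close, so the bad indices are counted separately for each parity. *)

Definition holomorphic_at (f : C -> C) (p : C) : Prop :=
  exists l : C, forall eps : R, 0 < eps -> exists delta : R, 0 < delta /\
    forall s : C, Cmod (s - p) < delta ->
      Cmod (f s - f p - l * (s - p)) <= eps * Cmod (s - p).

Lemma locally_of_Cmod (p : C) (P : C -> Prop) (d : R) :
  0 < d -> (forall s : C, Cmod (s - p) < d -> P s) ->
  locally (T := AbsRing_UniformSpace C_AbsRing) p P.
Proof. by move=> Hd H; exists (mkposreal d Hd) => s Hs; exact: H. Qed.

Lemma holomorphic_at_iff (f : C -> C) (p : C) :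
  holomorphic_at f p <->
  ex_derive (K := C_AbsRing) (V := AbsRing_NormedModule C_AbsRing) f p.
Proof.
split.
- move=> [l Hl]; exists l; split; first exact: is_linear_scal_l.
  move=> x Hx eps.
  have -> : x = p by symmetry; exact: (is_filter_lim_locally_unique (K := C_AbsRing) (V := AbsRing_NormedModule C_AbsRing)).
  have [d [Hd H]] := Hl eps (cond_pos eps).
  apply: (locally_of_Cmod _ _ d Hd) => s Hs.
  have := H s Hs; by rewrite (Cmult_comm l).
- move=> [l [_ H]]; exists l => eps Heps.
  have [d Hd] := H p (fun P HP => HP) (mkposreal eps Heps).
  exists d; split; first exact: cond_pos.
  move=> s Hs; have := Hd s Hs; by rewrite (Cmult_comm l).
Qed.

(** The module structure on the target is left to inference here, as in [is_riemann_zeta];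
    [holomorphic_at_iff] fixes the one of [AbsRing_NormedModule], for which the differentiation
    rules are applied. *)
Lemma holomorphic_at_ex_derive (f : C -> C) (p : C) :
  ex_derive (K := C_AbsRing) f p -> holomorphic_at f p.
Proof.
move=> [l [_ H]]; exists l => eps Heps.
have [d Hd] := H p (fun P HP => HP) (mkposreal eps Heps).
exists d; split; first exact: cond_pos.
move=> s Hs; have := Hd s Hs; by rewrite (Cmult_comm l).
Qed.

Lemma holomorphic_at_ext (f g : C -> C) (p : C) :
  (forall s, f s = g s) -> holomorphic_at f p -> holomorphic_at g p.
Proof.
move=> E [l Hl]; exists l => eps Heps; have [d [Hd H]] := Hl eps Heps.
by exists d; split=> // s Hs; rewrite -!E; exact: H.
Qed.

Lemma holomorphic_at_const (c p : C) : holomorphic_at (fun _ => c) p.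
Proof. apply/holomorphic_at_iff; exact: ex_derive_const. Qed.

Lemma holomorphic_at_id (p : C) : holomorphic_at (fun s => s) p.
Proof. apply/holomorphic_at_iff; exact: ex_derive_id. Qed.

Lemma holomorphic_at_plus (f g : C -> C) (p : C) :
  holomorphic_at f p -> holomorphic_at g p -> holomorphic_at (fun s => f s + g s)%C p.
Proof. move=> /holomorphic_at_iff Hf /holomorphic_at_iff Hg; apply/holomorphic_at_iff; exact: (ex_derive_plus (K := C_AbsRing) (V := AbsRing_NormedModule C_AbsRing)). Qed.

Lemma holomorphic_at_opp (f : C -> C) (p : C) :
  holomorphic_at f p -> holomorphic_at (fun s => - f s)%C p.
Proof. move=> /holomorphic_at_iff Hf; apply/holomorphic_at_iff; exact: (ex_derive_opp (K := C_AbsRing) (V := AbsRing_NormedModule C_AbsRing)). Qed.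

Lemma holomorphic_at_minus (f g : C -> C) (p : C) :
  holomorphic_at f p -> holomorphic_at g p -> holomorphic_at (fun s => f s - g s)%C p.
Proof. by move=> Hf Hg; apply: holomorphic_at_plus => //; exact: holomorphic_at_opp. Qed.

Lemma holomorphic_at_mult (f g : C -> C) (p : C) :
  holomorphic_at f p -> holomorphic_at g p -> holomorphic_at (fun s => f s * g s)%C p.
Proof.
move=> /holomorphic_at_iff [a Ha] /holomorphic_at_iff [b Hb]; apply/holomorphic_at_iff.
eexists; apply: (is_derive_mult (K := C_AbsRing) _ _ _ _ _ Ha Hb); exact: Cmult_comm.
Qed.

Lemma holomorphic_at_comp (f g : C -> C) (p : C) :
  holomorphic_at f (g p) -> holomorphic_at g p -> holomorphic_at (fun s => f (g s)) p.
Proof. move=> /holomorphic_at_iff Hf /holomorphic_at_iff Hg; apply/holomorphic_at_iff; exact: (ex_derive_comp (K := C_AbsRing) (V := AbsRing_NormedModule C_AbsRing)). Qed.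

Lemma holomorphic_at_continuous (f : C -> C) (p : C) (eps : R) :
  holomorphic_at f p -> 0 < eps -> exists delta : R, 0 < delta /\
    forall s : C, Cmod (s - p) < delta -> Cmod (f s - f p) < eps.
Proof.
move=> [l Hl] Heps.
have [d [Hd H]] := Hl 1 Rlt_0_1.
have Hl0 := Cmod_ge_0 l.
have Hp : 0 < eps / (2 + Cmod l) by apply: Rdiv_lt_0_compat; lra.
exists (Rmin d (eps / (2 + Cmod l))); split; first exact: Rmin_pos.
move=> s Hs.
have H1 := H s (Rlt_le_trans _ _ _ Hs (Rmin_l _ _)).
have H2 := Rlt_le_trans _ _ _ Hs (Rmin_r _ _).
have -> : (f s - f p = (f s - f p - l * (s - p)) + l * (s - p))%C by ring.
apply: Rle_lt_trans (Cmod_triangle _ _) _.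
rewrite Cmod_mult.
have H3 : Cmod (s - p) * (2 + Cmod l) < eps.
  have H4 : 0 < 2 + Cmod l by lra.
  have := Rmult_lt_compat_r _ _ _ H4 H2.
  by have -> : eps / (2 + Cmod l) * (2 + Cmod l) = eps by field; lra.
have := Cmod_ge_0 (s - p); nra.
Qed.

Lemma holomorphic_at_inv (p : C) : p <> 0%C -> holomorphic_at Cinv p.
Proof.
move=> Hp; exists (- / (p * p))%C => eps Heps.
have Hm : 0 < Cmod p by apply/Cmod_gt_0.
have H3 : 0 < Cmod p ^ 3 by apply: pow_lt.
exists (Rmin (Cmod p / 2) (eps * Cmod p ^ 3 / 2)); split.
  by apply: Rmin_pos; nra.
move=> s Hs.
have H1 := Rlt_le_trans _ _ _ Hs (Rmin_l _ _).
have H2 := Rlt_le_trans _ _ _ Hs (Rmin_r _ _).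
have Hs2 : Cmod p / 2 <= Cmod s.
  have := Cmod_triangle s (p - s).
  have -> : (s + (p - s) = p)%C by ring.
  have -> : (p - s = - (s - p))%C by ring.
  rewrite Cmod_opp; lra.
have Hs0 : s <> 0%C by apply/Cmod_gt_0; lra.
have -> : (/ s - / p - - / (p * p) * (s - p) = (s - p) * (s - p) * / (s * (p * p)))%C.
  field; split; assumption.
have Hpp : (p * p <> 0)%C by apply: Cmult_neq_0.
have Hspp : (s * (p * p) <> 0)%C by apply: Cmult_neq_0.
rewrite 2!Cmod_mult Cmod_inv // 2!Cmod_mult.
rewrite [X in _ <= X]Rmult_comm Rmult_assoc; apply: Rmult_le_compat_l; first exact: Cmod_ge_0.
have Hb : 0 < Cmod s * (Cmod p * Cmod p) by apply: Rmult_lt_0_compat; nra.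
apply (Rmult_le_reg_r (Cmod s * (Cmod p * Cmod p))) => //.
rewrite Rmult_assoc Rinv_l ?Rmult_1_r; last lra.
apply: Rle_trans (Rlt_le _ _ H2) _.
have : eps * Cmod p ^ 2 * (Cmod p / 2) <= eps * Cmod p ^ 2 * Cmod s.
  by apply: Rmult_le_compat_l => //; nra.
by move=> ?; nra.
Qed.

(** The supremum of the left endpoints lies in every interval. *)
Lemma nested_point (a b : nat -> R) :
  (forall n, a n <= a (S n)) -> (forall n, b (S n) <= b n) -> (forall n, a n <= b n) ->
  exists x, forall n, a n <= x <= b n.
Proof.
move=> Ha Hb Hab.
have Ham : forall n k, a n <= a (n + k)%nat.
  move=> n; elim=> [|k IH]; first by rewrite Nat.add_0_r; lra.
  by rewrite Nat.add_succ_r; have := Ha (n + k)%nat; lra.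
have Hbm : forall n k, b (n + k)%nat <= b n.
  move=> n; elim=> [|k IH]; first by rewrite Nat.add_0_r; lra.
  by rewrite Nat.add_succ_r; have := Hb (n + k)%nat; lra.
have Hub : forall n m, a n <= b m.
  move=> n m; have := Ham n m; have := Hbm m n; have := Hab (n + m)%nat.
  rewrite (Nat.add_comm m n); lra.
have [x [Hx1 Hx2]] : {x | is_lub (fun y => exists n, y = a n) x}.
  apply: completeness; last by exists (a 0%nat), 0%nat.
  by exists (b 0%nat) => _ [n ->].
exists x => n; split; first by apply: Hx1; exists n.
by apply: Hx2 => _ [m ->].
Qed.

(** Compactness by quartering: if [P] fails, it fails on one of the four quarters, and so on; the
    nested bad rectangles shrink to a point, where the local hypothesis contradicts them. It serves
    both Goursat's theorem and boundedness on rectangles. *)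
Lemma rectangle_induction (P : R -> R -> R -> R -> Prop) (a0 b0 c0 d0 : R) :
  a0 <= b0 -> c0 <= d0 ->
  (forall a b c d, a0 <= a -> a <= b -> b <= b0 -> c0 <= c -> c <= d -> d <= d0 ->
     P a ((a + b) / 2) c ((c + d) / 2) -> P ((a + b) / 2) b c ((c + d) / 2) ->
     P a ((a + b) / 2) ((c + d) / 2) d -> P ((a + b) / 2) b ((c + d) / 2) d ->
     P a b c d) ->
  (forall x y, a0 <= x <= b0 -> c0 <= y <= d0 -> exists delta, 0 < delta /\
     forall a b c d, a0 <= a <= x -> x <= b <= b0 -> c0 <= c <= y -> y <= d <= d0 ->
       b - a < delta -> d - c < delta -> P a b c d) ->
  P a0 b0 c0 d0.
Proof.
move=> Hab0 Hcd0 Hsplit Hloc; apply: NNPP => HP0.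
pose bad (q : R * R * R * R) := let '(a, b, c, d) := q in
  a0 <= a /\ a <= b /\ b <= b0 /\ c0 <= c /\ c <= d /\ d <= d0 /\ ~ P a b c d.
pose half (q q' : R * R * R * R) := let '(a, b, c, d) := q in let '(a', b', c', d') := q' in
  a <= a' /\ b' <= b /\ c <= c' /\ d' <= d /\ b' - a' = (b - a) / 2 /\ d' - c' = (d - c) / 2.
(* The implication stands inside the existential so that choice yields a total function [step] on
   quadruples. *)
have Hstep : forall q, exists q', bad q -> bad q' /\ half q q'.
  move=> [[[a b] c] d].
  have [Hbad|] := classic (bad (a, b, c, d)); last by move=> H; exists (a, b, c, d).
  case: (Hbad) => H1 [H2 [H3 [H4 [H5 [H6 H7]]]]].
  have [K1|K1] := classic (P a ((a + b) / 2) c ((c + d) / 2)); last first.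
    by exists (a, (a + b) / 2, c, (c + d) / 2) => _; rewrite /bad /half; repeat split; try lra.
  have [K2|K2] := classic (P ((a + b) / 2) b c ((c + d) / 2)); last first.
    by exists ((a + b) / 2, b, c, (c + d) / 2) => _; rewrite /bad /half; repeat split; try lra.
  have [K3|K3] := classic (P a ((a + b) / 2) ((c + d) / 2) d); last first.
    by exists (a, (a + b) / 2, (c + d) / 2, d) => _; rewrite /bad /half; repeat split; try lra.
  have [K4|K4] := classic (P ((a + b) / 2) b ((c + d) / 2) d); last first.
    by exists ((a + b) / 2, b, (c + d) / 2, d) => _; rewrite /bad /half; repeat split; try lra.
  by case: H7; apply: Hsplit.
pose step q := proj1_sig (constructive_indefinite_description _ (Hstep q)).
have stepP : forall q, bad q -> bad (step q) /\ half q (step q).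
  by move=> q; exact: (proj2_sig (constructive_indefinite_description _ (Hstep q))).
pose q := fix q n := match n with O => (a0, b0, c0, d0) | S n => step (q n) end.
have Hbad : forall n, bad (q n).
  elim=> [|n IH]; last by apply stepP.
  by rewrite /bad /=; repeat split; try lra.
have Hhalf : forall n, half (q n) (q (S n)) by move=> n; apply stepP.
pose A n := fst (fst (fst (q n))); pose B n := snd (fst (fst (q n))).
pose E n := snd (fst (q n)); pose D n := snd (q n).
have Hq : forall n, q n = (A n, B n, E n, D n).
  by move=> n; rewrite /A /B /E /D; case: (q n) => [[[? ?] ?] ?].
have HB : forall n, bad (A n, B n, E n, D n) by move=> n; rewrite -Hq.
have HH : forall n, half (A n, B n, E n, D n) (A (S n), B (S n), E (S n), D (S n)).
  by move=> n; rewrite -!Hq.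
have [x Hx] : exists x, forall n, A n <= x <= B n.
  by apply: nested_point => n; [case: (HH n) | case: (HH n) => _ [] | case: (HB n) => _ []].
have [y Hy] : exists y, forall n, E n <= y <= D n.
  apply: nested_point => n; [| |]; have := HH n; have := HB n; rewrite /bad /half; tauto.
have [delta [Hdelta Hd]] : exists delta, 0 < delta /\
     forall a b c d, a0 <= a <= x -> x <= b <= b0 -> c0 <= c <= y -> y <= d <= d0 ->
       b - a < delta -> d - c < delta -> P a b c d.
  by apply: Hloc; [have := Hx 0%nat | have := Hy 0%nat].
have Hlen : forall n, B n - A n = (b0 - a0) / 2 ^ n /\ D n - E n = (d0 - c0) / 2 ^ n.
  elim=> [|n [IH1 IH2]]; first by rewrite /A /B /E /D /=; split; field.
  case: (HH n) => _ [_ [_ [_ [-> ->]]]]; rewrite IH1 IH2 /=.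
  by split; field; apply: pow_nonzero; lra.
(* After this many halvings both sides are shorter than the [delta] of the limit point. *)
have [n Hn] : exists n, (b0 - a0 + (d0 - c0)) / delta < 2 ^ n.
  have [n Hn] := Pow_x_infinity 2 ltac:(rewrite Rabs_right; lra) ((b0 - a0 + (d0 - c0)) / delta + 1).
  exists n; have := Hn n (le_n _); rewrite Rabs_right; first by lra.
  by apply: Rle_ge; apply: pow_le; lra.
have Hn' : (b0 - a0 + (d0 - c0)) / 2 ^ n < delta.
  have H2 : 0 < 2 ^ n by apply: pow_lt; lra.
  apply (Rmult_lt_reg_r (2 ^ n)) => //.
  have -> : (b0 - a0 + (d0 - c0)) / 2 ^ n * 2 ^ n = (b0 - a0 + (d0 - c0)) / delta * delta by field; lra.
  by rewrite (Rmult_comm delta); apply: Rmult_lt_compat_r.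
have Hi : 0 < / 2 ^ n by apply: Rinv_0_lt_compat; apply: pow_lt; lra.
case: (Hlen n) => Hl1 Hl2.
case: (HB n) => K1 [K2 [K3 [K4 [K5 [K6]]]]]; apply.
apply: Hd; [have := Hx n; lra | have := Hx n; lra | have := Hy n; lra | have := Hy n; lra | |].
- rewrite Hl1; apply: Rle_lt_trans Hn'; rewrite /Rdiv; apply: Rmult_le_compat_r; lra.
- rewrite Hl2; apply: Rle_lt_trans Hn'; rewrite /Rdiv; apply: Rmult_le_compat_r; lra.
Qed.

Definition holomorphic_on_rectangle (f : C -> C) (a b c d : R) : Prop :=
  forall x y : R, a <= x <= b -> c <= y <= d -> holomorphic_at f (x, y).

(* The imaginary part of the integral of [f] along the positively oriented
   boundary of [[a, b] x [c, d]]. *)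
Definition contour_im (f : C -> C) (a b c d : R) : R :=
  RInt (fun x => Im (f (x, c))) a b - RInt (fun x => Im (f (x, d))) a b
  + RInt (fun y => Re (f (b, y))) c d - RInt (fun y => Re (f (a, y))) c d.

Lemma im_le_Cmod (z : C) : Rabs (Im z) <= Cmod z.
Proof. exact: Rle_trans (Rmax_r _ _) (Rmax_Cmod z). Qed.

Lemma Cmod_le_sum (z : C) : Cmod z <= Rabs (Re z) + Rabs (Im z).
Proof.
have H1 := Rabs_pos (Re z); have H2 := Rabs_pos (Im z).
apply: Rsqr_incr_0_var; last lra.
rewrite /Rsqr; have := Cmod2_alt z.
rewrite -(pow2_abs (Re z)) -(pow2_abs (Im z)) /=; nra.
Qed.

(** Here [phi] stands for [Re] or [Im], and [gamma] for a horizontal or vertical side of a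
    rectangle. *)
Lemma continuous_slice (phi : C -> R) (gamma : R -> C) (f : C -> C) (t : R) :
  (forall z w, Rabs (phi z - phi w) <= Cmod (z - w)) ->
  (forall x, Cmod (gamma x - gamma t) <= Rabs (x - t)) ->
  holomorphic_at f (gamma t) -> continuous (fun x => phi (f (gamma x))) t.
Proof.
move=> Hphi Hg Hf; apply/filterlim_locally => eps.
have [d [Hd H]] := holomorphic_at_continuous f _ eps Hf (cond_pos eps).
exists (mkposreal d Hd) => x Hx.
rewrite /ball /= /AbsRing_ball /abs /minus /plus /opp /=.
apply: Rle_lt_trans (Hphi _ _) _; apply: H.
exact: Rle_lt_trans (Hg x) Hx.
Qed.

Lemma Re_lipschitz (z w : C) : Rabs (Re z - Re w) <= Cmod (z - w).
Proof. by have := re_le_Cmod (z - w)%C. Qed.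

Lemma Im_lipschitz (z w : C) : Rabs (Im z - Im w) <= Cmod (z - w).
Proof. by have := im_le_Cmod (z - w)%C. Qed.

Lemma horizontal_path (c t x : R) : Cmod ((x, c) - (t, c)) <= Rabs (x - t).
Proof.
apply: Rle_trans (Cmod_le_sum _) _; rewrite /= .
have -> : c + - c = 0 by ring.
by rewrite Rabs_R0 Rplus_0_r; apply: Rle_refl.
Qed.

Lemma vertical_path (a t y : R) : Cmod ((a, y) - (a, t)) <= Rabs (y - t).
Proof.
apply: Rle_trans (Cmod_le_sum _) _; rewrite /= .
have -> : a + - a = 0 by ring.
by rewrite Rabs_R0 Rplus_0_l; apply: Rle_refl.
Qed.

Lemma ex_RInt_horizontal (f : C -> C) (a b c : R) : a <= b ->
  (forall x, a <= x <= b -> holomorphic_at f (x, c)) ->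
  ex_RInt (fun x => Im (f (x, c))) a b.
Proof.
move=> Hab Hf; apply: (ex_RInt_continuous (V := R_CompleteNormedModule)) => x.
rewrite Rmin_left // Rmax_right // => Hx.
apply: (continuous_slice Im (fun x => (x, c))); [exact: Im_lipschitz | exact: horizontal_path | exact: Hf].
Qed.

Lemma ex_RInt_vertical (f : C -> C) (a c d : R) : c <= d ->
  (forall y, c <= y <= d -> holomorphic_at f (a, y)) ->
  ex_RInt (fun y => Re (f (a, y))) c d.
Proof.
move=> Hcd Hf; apply: (ex_RInt_continuous (V := R_CompleteNormedModule)) => y.
rewrite Rmin_left // Rmax_right // => Hy.
apply: (continuous_slice Re (fun y => (a, y))); [exact: Re_lipschitz | exact: vertical_path | exact: Hf].
Qed.

Lemma contour_im_split_vertical (f : C -> C) (a m b c d : R) :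
  a <= m <= b ->
  (forall x, a <= x <= b -> holomorphic_at f (x, c) /\ holomorphic_at f (x, d)) ->
  contour_im f a b c d = contour_im f a m c d + contour_im f m b c d.
Proof.
move=> Hm Hf; rewrite /contour_im.
rewrite -(RInt_Chasles (V := R_CompleteNormedModule) (fun x => Im (f (x, c))) a m b).
- rewrite -(RInt_Chasles (V := R_CompleteNormedModule) (fun x => Im (f (x, d))) a m b).
  + rewrite /plus /=; ring.
  + by apply: ex_RInt_horizontal => [|x Hx]; [lra | apply Hf; lra].
  + by apply: ex_RInt_horizontal => [|x Hx]; [lra | apply Hf; lra].
- by apply: ex_RInt_horizontal => [|x Hx]; [lra | apply Hf; lra].
- by apply: ex_RInt_horizontal => [|x Hx]; [lra | apply Hf; lra].
Qed.

Lemma contour_im_split_horizontal (f : C -> C) (a b c m d : R) :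
  c <= m <= d ->
  (forall y, c <= y <= d -> holomorphic_at f (a, y) /\ holomorphic_at f (b, y)) ->
  contour_im f a b c d = contour_im f a b c m + contour_im f a b m d.
Proof.
move=> Hm Hf; rewrite /contour_im.
rewrite -(RInt_Chasles (V := R_CompleteNormedModule) (fun y => Re (f (a, y))) c m d).
- rewrite -(RInt_Chasles (V := R_CompleteNormedModule) (fun y => Re (f (b, y))) c m d).
  + rewrite /plus /=; ring.
  + by apply: ex_RInt_vertical => [|x Hx]; [lra | apply Hf; lra].
  + by apply: ex_RInt_vertical => [|x Hx]; [lra | apply Hf; lra].
- by apply: ex_RInt_vertical => [|x Hx]; [lra | apply Hf; lra].
- by apply: ex_RInt_vertical => [|x Hx]; [lra | apply Hf; lra].
Qed.

Lemma RInt_affine_approx (g : R -> R) (a b k0 k1 M : R) :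
  a <= b -> ex_RInt g a b ->
  (forall x, a <= x <= b -> Rabs (g x - (k0 + k1 * x)) <= M) ->
  Rabs (RInt g a b - (k0 * (b - a) + k1 * (b ^ 2 - a ^ 2) / 2)) <= (b - a) * M.
Proof.
move=> Hab Hg HM.
have Haff : is_RInt (fun x => k0 + k1 * x) a b (k0 * (b - a) + k1 * (b ^ 2 - a ^ 2) / 2).
  have -> : k0 * (b - a) + k1 * (b ^ 2 - a ^ 2) / 2
    = minus (k0 * b + k1 * b ^ 2 / 2) (k0 * a + k1 * a ^ 2 / 2).
    by rewrite /minus /plus /opp /=; field.
  apply: (is_RInt_derive (fun x => k0 * x + k1 * x ^ 2 / 2)).
  - by move=> x _; auto_derive => //; field.
  - by move=> x _; apply: (ex_derive_continuous (K := R_AbsRing) (V := R_NormedModule)); auto_derive.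
apply: (norm_RInt_le_const (V := R_NormedModule) (fun x => minus (g x) (k0 + k1 * x)) a b) => //.
apply: is_RInt_minus => //; exact: RInt_correct.
Qed.

(** The local step of Goursat's theorem: the affine part of [f] at [p] integrates to zero around the
    rectangle, and the remainder contributes at most its supremum times the perimeter
    [2 * (b - a + (d - c))]. *)
Lemma contour_im_small (f : C -> C) (p l : C) (eps a b c d : R) :
  a <= Re p <= b -> c <= Im p <= d -> holomorphic_on_rectangle f a b c d ->
  (forall x y, a <= x <= b -> c <= y <= d ->
     Cmod (f (x, y) - f p - l * ((x, y) - p)) <= eps * (b - a + (d - c))) ->
  Rabs (contour_im f a b c d) <= 2 * eps * (b - a + (d - c)) ^ 2.
Proof.
move=> Hx Hy Hf H.
case: p Hx Hy H => x0 y0 /= Hx0 Hy0 H.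
case: l H => l1 l2 H.
set fp := f (x0, y0).
have HI : forall x y, a <= x <= b -> c <= y <= d ->
    Rabs (Im (f (x, y)) - (Im fp + l1 * (y - y0) + l2 * (x - x0))) <= eps * (b - a + (d - c)).
  move=> x y Hx Hy; apply: Rle_trans (H x y Hx Hy).
  apply: Rle_trans (im_le_Cmod _); right; congr Rabs; rewrite /fp /Im /Re /=; ring.
have HR : forall x y, a <= x <= b -> c <= y <= d ->
    Rabs (Re (f (x, y)) - (Re fp + l1 * (x - x0) - l2 * (y - y0))) <= eps * (b - a + (d - c)).
  move=> x y Hx Hy; apply: Rle_trans (H x y Hx Hy).
  apply: Rle_trans (re_le_Cmod _); right; congr Rabs; rewrite /fp /Im /Re /=; ring.
rewrite /contour_im.
have B1 := RInt_affine_approx (fun x => Im (f (x, c))) a b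
  (Im fp + l1 * (c - y0) - l2 * x0) l2 (eps * (b - a + (d - c))) ltac:(lra)
  ltac:(by apply: ex_RInt_horizontal => [|x Hx]; [lra | apply: Hf; lra]) ltac:(
  move=> x Hx; have := HI x c Hx ltac:(lra); congr (Rabs _ <= _); cbv beta; ring).
have B2 := RInt_affine_approx (fun x => Im (f (x, d))) a b
  (Im fp + l1 * (d - y0) - l2 * x0) l2 (eps * (b - a + (d - c))) ltac:(lra)
  ltac:(by apply: ex_RInt_horizontal => [|x Hx]; [lra | apply: Hf; lra]) ltac:(
  move=> x Hx; have := HI x d Hx ltac:(lra); congr (Rabs _ <= _); cbv beta; ring).
have B3 := RInt_affine_approx (fun y => Re (f (b, y))) c d
  (Re fp + l1 * (b - x0) + l2 * y0) (- l2) (eps * (b - a + (d - c))) ltac:(lra)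
  ltac:(by apply: ex_RInt_vertical => [|x Hx]; [lra | apply: Hf; lra]) ltac:(
  move=> y Hy; have := HR b y ltac:(lra) Hy; congr (Rabs _ <= _); cbv beta; ring).
have B4 := RInt_affine_approx (fun y => Re (f (a, y))) c d
  (Re fp + l1 * (a - x0) + l2 * y0) (- l2) (eps * (b - a + (d - c))) ltac:(lra)
  ltac:(by apply: ex_RInt_vertical => [|x Hx]; [lra | apply: Hf; lra]) ltac:(
  move=> y Hy; have := HR a y ltac:(lra) Hy; congr (Rabs _ <= _); cbv beta; ring).
move: B1 B2 B3 B4.
set I1 := RInt _ _ _; set I2 := RInt _ a b; set I3 := RInt _ c d; set I4 := RInt _ c d.
move=> B1 B2 B3 B4.
set A1 := (_ + _) in B1; set A2 := (_ + _) in B2; set A3 := (_ + _) in B3; set A4 := (_ + _) in B4.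
(* This is the vanishing of the affine part: [A1 - A2 + A3 - A4 = 0]. *)
have E : I1 - I2 + I3 - I4 = (I1 - A1) - (I2 - A2) + (I3 - A3) - (I4 - A4).
  rewrite /A1 /A2 /A3 /A4; field.
rewrite E.
move: B1 B2 B3 B4 => /Rabs_le_between B1 /Rabs_le_between B2 /Rabs_le_between B3 /Rabs_le_between B4.
apply/Rabs_le_between; split; lra.
Qed.

(** Goursat's theorem. The bound [eps * (b - a + (d - c)) ^ 2] is preserved by quartering, since
    each quarter has a quarter of the right-hand side, so it passes from small rectangles to the
    whole one for every [eps]. *)
Lemma contour_im_holomorphic (f : C -> C) (a b c d : R) :
  a <= b -> c <= d -> holomorphic_on_rectangle f a b c d -> contour_im f a b c d = 0.
Proof.
move=> Hab Hcd Hf.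
have Hall : forall eps, 0 < eps -> Rabs (contour_im f a b c d) <= eps * (b - a + (d - c)) ^ 2.
  move=> eps Heps.
  pose P a b c d := Rabs (contour_im f a b c d) <= eps * (b - a + (d - c)) ^ 2.
  apply: (rectangle_induction P) => //; rewrite /P.
  - move=> a' b' c' d' H1 H2 H3 H4 H5 H6 K1 K2 K3 K4.
    have Hf' : forall x y, a' <= x <= b' -> c' <= y <= d' -> holomorphic_at f (x, y).
      by move=> x y Hx Hy; apply: Hf; lra.
    rewrite (contour_im_split_vertical f a' ((a' + b') / 2) b'); [|lra|by move=> x Hx; split; apply: Hf'; lra].
    rewrite (contour_im_split_horizontal f a' _ c' ((c' + d') / 2) d'); [|lra|by move=> y Hy; split; apply: Hf'; lra].
    rewrite (contour_im_split_horizontal f _ b' c' ((c' + d') / 2) d'); [|lra|by move=> y Hy; split; apply: Hf'; lra].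
    move: K1 K2 K3 K4 => /Rabs_le_between K1 /Rabs_le_between K2 /Rabs_le_between K3 /Rabs_le_between K4.
    apply/Rabs_le_between; split; nra.
  - move=> x y Hx Hy.
    have [l Hl] := Hf x y Hx Hy.
    have [delta [Hd H]] := Hl (eps / 2) ltac:(lra).
    exists (delta / 2); split; first lra.
    move=> a' b' c' d' Ha Hb Hc Hd' Hw Hh.
    have -> : eps = 2 * (eps / 2) by field.
    apply: (contour_im_small _ (x, y) l) => /=; [lra | lra | by move=> x' y' Hx' Hy'; apply: Hf; lra |].
    move=> x' y' Hx' Hy'.
    have Hdist : Cmod ((x', y') - (x, y)) <= b' - a' + (d' - c').
      apply: Rle_trans (Cmod_le_sum _) _; rewrite /=.
      by apply: Rplus_le_compat; apply/Rabs_le_between; lra.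
    apply: Rle_trans (H _ _) _; first lra.
    apply: Rmult_le_compat_l; lra.
apply: NNPP => Hn.
have Hp : 0 < Rabs (contour_im f a b c d) by apply: Rabs_pos_lt.
have Hs : 0 <= (b - a + (d - c)) ^ 2 by apply: pow2_ge_0.
(* With this [eps] a nonzero value would be at most half of itself; the [+ 1] covers a degenerate
   rectangle. *)
have := Hall (Rabs (contour_im f a b c d) / (2 * ((b - a + (d - c)) ^ 2 + 1))) ltac:(apply: Rdiv_lt_0_compat; lra).
set X := Rabs _ in Hp *; set S := (_ ^ 2) in Hs *.
have -> : X / (2 * (S + 1)) * S = X * (S / (2 * (S + 1))) by field; lra.
have : S / (2 * (S + 1)) <= / 2.
  apply (Rmult_le_reg_r (2 * (S + 1))); first lra.
  have -> : S / (2 * (S + 1)) * (2 * (S + 1)) = S by field; lra.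
  have -> : / 2 * (2 * (S + 1)) = S + 1 by field. lra.
nra.
Qed.

Lemma RInt_const_le (g : R -> R) (a b k : R) :
  a <= b -> ex_RInt g a b -> (forall x, a <= x <= b -> k <= g x) -> k * (b - a) <= RInt g a b.
Proof.
move=> Hab Hg H.
have -> : k * (b - a) = RInt (fun _ => k) a b by rewrite RInt_const /scal /= /mult /=; ring.
by apply: RInt_le => // [|x Hx]; [exact: ex_RInt_const | apply: H; lra].
Qed.

Lemma RInt_le_const (g : R -> R) (a b k : R) :
  a <= b -> ex_RInt g a b -> (forall x, a <= x <= b -> g x <= k) -> RInt g a b <= k * (b - a).
Proof.
move=> Hab Hg H.
have -> : k * (b - a) = RInt (fun _ => k) a b by rewrite RInt_const /scal /= /mult /=; ring.
by apply: RInt_le => // [|x Hx]; [exact: ex_RInt_const | apply: H; lra].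
Qed.

(** * The maximum principle with constant 4 *)

Definition on_square_boundary (z : C) (r : R) (s : C) : Prop :=
  Rabs (Re s - Re z) <= r /\ Rabs (Im s - Im z) <= r /\
  (Rabs (Re s - Re z) = r \/ Rabs (Im s - Im z) = r).

Definition holomorphic_on_square (f : C -> C) (z : C) (r : R) : Prop :=
  holomorphic_on_rectangle f (Re z - r) (Re z + r) (Im z - r) (Im z + r).

Lemma holomorphic_at_div_shift (g : C -> C) (z p : C) :
  p <> z -> holomorphic_at g p -> holomorphic_at (fun s => g s / (s - z))%C p.
Proof.
move=> Hp Hg; apply: holomorphic_at_mult => //.
apply: (holomorphic_at_comp Cinv (fun s => s - z)%C).
- by apply: holomorphic_at_inv => H; apply: Hp; rewrite -(Cplus_0_r z) -H; ring.
- by apply: holomorphic_at_minus; [exact: holomorphic_at_id | exact: holomorphic_at_const].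
Qed.

(** The frame between the two squares is cut into four rectangles avoiding the centre, and Goursat's
    theorem removes each of them. *)
Lemma contour_im_shrink (q : C -> C) (x y r e : R) :
  0 < e <= r ->
  (forall s, Rabs (Re s - x) <= r -> Rabs (Im s - y) <= r -> s <> (x, y) -> holomorphic_at q s) ->
  contour_im q (x - r) (x + r) (y - r) (y + r) = contour_im q (x - e) (x + e) (y - e) (y + e).
Proof.
move=> He Hq.
have Hq1 : forall a b, x - r <= a <= x + r -> y - r <= b <= y + r -> (a <> x \/ b <> y) ->
    holomorphic_at q (a, b).
  move=> a b Ha Hb Hab; apply: Hq; [apply/Rabs_le_between => /=; lra | apply/Rabs_le_between => /=; lra |].
  by move=> [? ?]; case: Hab.
rewrite (contour_im_split_vertical q (x - r) (x - e) (x + r)); [|lra|].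
  rewrite (contour_im_holomorphic q (x - r)); [|lra|lra|]; last first.
    by move=> a b Ha Hb; apply: Hq1; lra.
  rewrite (contour_im_split_vertical q (x - e) (x + e) (x + r)); [|lra|].
    rewrite (contour_im_holomorphic q (x + e)); [|lra|lra|]; last first.
      by move=> a b Ha Hb; apply: Hq1; lra.
    rewrite (contour_im_split_horizontal q _ _ (y - r) (y - e)); [|lra|].
      rewrite (contour_im_holomorphic q _ _ (y - r)); [|lra|lra|]; last first.
        by move=> a b Ha Hb; apply: Hq1; lra.
      rewrite (contour_im_split_horizontal q _ _ (y - e) (y + e)); [|lra|].
        rewrite (contour_im_holomorphic q _ _ (y + e)); [|lra|lra|]; last first.
          by move=> a b Ha Hb; apply: Hq1; lra.
        ring.
      by move=> b Hb; split; apply: Hq1; lra.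
    by move=> b Hb; split; apply: Hq1; lra.
  by move=> b Hb; split; apply: Hq1; lra.
by move=> b Hb; split; apply: Hq1; lra.
Qed.

Lemma Cdiv_shift_Re_Im (g s z : C) : s <> z ->
  let u := Re s - Re z in let v := Im s - Im z in
  Re (g / (s - z)) = (Re g * u + Im g * v) / (u ^ 2 + v ^ 2) /\
  Im (g / (s - z)) = (Im g * u - Re g * v) / (u ^ 2 + v ^ 2).
Proof.
case: g => g1 g2; case: s => s1 s2; case: z => z1 z2 Hs /=.
have Hn : (s1 - z1) ^ 2 + (s2 - z2) ^ 2 <> 0.
  have H1 := pow2_ge_0 (s1 - z1); have H2 := pow2_ge_0 (s2 - z2).
  move=> H; apply: Hs; f_equal; nra.
rewrite /Re /Im /=; split; field; move: Hn => /=; rewrite /Rminus; nra.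
Qed.

(* [contour_im] of [g s / (s - z)] is at most [8 M] over the given square; over
   a small concentric one, where [g] is close to [1], it is at least [2]. *)
Lemma weak_maximum_principle_normalized (g : C -> C) (z : C) (r M : R) :
  0 < r -> holomorphic_on_square g z r -> g z = RtoC 1 ->
  (forall s, on_square_boundary z r s -> Cmod (g s) <= M) -> / 4 <= M.
Proof.
case: z => x y Hr Hg Hgz HM.
have Hsq : forall s, Rabs (Re s - x) <= r -> Rabs (Im s - y) <= r -> holomorphic_at g s.
  move=> [a b] /= /Rabs_le_between H1 /Rabs_le_between H2; apply: Hg => /=; lra.
pose q s := (g s / (s - (x, y)))%C.
have Hq : forall s, Rabs (Re s - x) <= r -> Rabs (Im s - y) <= r -> s <> (x, y) -> holomorphic_at q s.
  by move=> s H1 H2 Hs; apply: holomorphic_at_div_shift => //; exact: Hsq.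
have Hq1 : forall a b, x - r <= a <= x + r -> y - r <= b <= y + r -> (a <> x \/ b <> y) ->
    holomorphic_at q (a, b).
  move=> a b Ha Hb Hab; apply: Hq; [apply/Rabs_le_between => /=; lra | apply/Rabs_le_between => /=; lra |].
  by move=> [? ?]; case: Hab.
have [d [Hd Hcont]] := holomorphic_at_continuous g (x, y) (/ 8) (Hg x y ltac:(move=> /=; lra) ltac:(move=> /=; lra)) ltac:(lra).
(* Points of the small square are within [2 * e < d] of the centre, so [g] is within 1/8 of 1
   there. *)
pose e := Rmin (d / 3) r.
have He : 0 < e <= r by split; [apply: Rmin_pos; lra | exact: Rmin_r].
have Hed : e <= d / 3 by exact: Rmin_l.
have Hup : contour_im q (x - r) (x + r) (y - r) (y + r) <= 8 * M.
  have Hqb : forall s, on_square_boundary (x, y) r s -> Rabs (Re (q s)) <= M / r /\ Rabs (Im (q s)) <= M / r.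
    move=> s Hs.
    have Hz : r <= Cmod (s - (x, y)).
      case: (Hs) => _ [_ [<-|<-]]; [exact: (re_le_Cmod (s - (x, y)))|exact: (im_le_Cmod (s - (x, y)))].
    have Hz0 : (s - (x, y) <> 0)%C by apply/Cmod_gt_0; lra.
    have Hb : Cmod (q s) <= M / r.
      rewrite /q Cmod_div //; apply (Rmult_le_reg_r (Cmod (s - (x, y)) * r)); first nra.
      have -> : Cmod (g s) / Cmod (s - (x, y)) * (Cmod (s - (x, y)) * r) = Cmod (g s) * r by field; lra.
      have -> : M / r * (Cmod (s - (x, y)) * r) = M * Cmod (s - (x, y)) by field; lra.
      have := HM s Hs; have := Cmod_ge_0 (g s); nra.
    by split; apply: Rle_trans Hb; [exact: re_le_Cmod | exact: im_le_Cmod].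
  have Hb : forall a b, x - r <= a <= x + r -> y - r <= b <= y + r ->
      (a = x - r \/ a = x + r \/ b = y - r \/ b = y + r) ->
      on_square_boundary (x, y) r (a, b).
    move=> a b Ha Hb' H; split; first by apply/Rabs_le_between => /=; lra.
    split; first by apply/Rabs_le_between => /=; lra.
    case: H => [->|[->|[->|->]]]; [left|left|right|right] => /=.
    - by rewrite Rabs_left1; lra.
    - by rewrite Rabs_right; lra.
    - by rewrite Rabs_left1; lra.
    - by rewrite Rabs_right; lra.
  rewrite /contour_im.
  have B1 := RInt_le_const (fun a => Im (q (a, y - r))) (x - r) (x + r) (M / r) ltac:(lra)
    ltac:(by apply: ex_RInt_horizontal => [|a Ha]; [lra | apply: Hq1; lra])
    ltac:(by move=> a Ha; have [_ /Rabs_le_between []] := Hqb _ (Hb a (y - r) ltac:(lra) ltac:(lra) ltac:(tauto))).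
  have B2 := RInt_const_le (fun a => Im (q (a, y + r))) (x - r) (x + r) (- (M / r)) ltac:(lra)
    ltac:(by apply: ex_RInt_horizontal => [|a Ha]; [lra | apply: Hq1; lra])
    ltac:(by move=> a Ha; have [_ /Rabs_le_between []] := Hqb _ (Hb a (y + r) ltac:(lra) ltac:(lra) ltac:(tauto))).
  have B3 := RInt_le_const (fun b => Re (q (x + r, b))) (y - r) (y + r) (M / r) ltac:(lra)
    ltac:(by apply: ex_RInt_vertical => [|a Ha]; [lra | apply: Hq1; lra])
    ltac:(by move=> b Hb'; have [/Rabs_le_between [] //] := Hqb _ (Hb (x + r) b ltac:(lra) ltac:(lra) ltac:(tauto))).
  have B4 := RInt_const_le (fun b => Re (q (x - r, b))) (y - r) (y + r) (- (M / r)) ltac:(lra)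
    ltac:(by apply: ex_RInt_vertical => [|a Ha]; [lra | apply: Hq1; lra])
    ltac:(by move=> b Hb'; have [/Rabs_le_between [] //] := Hqb _ (Hb (x - r) b ltac:(lra) ltac:(lra) ltac:(tauto))).
  have E : M / r * (2 * r) = 2 * M by field; lra.
  have E1 : x + r - (x - r) = 2 * r by ring.
  have E2 : y + r - (y - r) = 2 * r by ring.
  rewrite !E1 in B1 B2; rewrite !E2 in B3 B4; lra.
rewrite (contour_im_shrink q x y r e) // in Hup.
have Hlow : 2 <= contour_im q (x - e) (x + e) (y - e) (y + e).
  have Hg1 : forall s, Rabs (Re s - x) <= e -> Rabs (Im s - y) <= e -> 7 / 8 <= Re (g s) /\ Rabs (Im (g s)) <= / 8.
    move=> s H1 H2.
    have Hs : Cmod (g s - g (x, y)) < / 8.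
      apply: Hcont; apply: Rle_lt_trans (Cmod_le_sum _) _.
      have : Rabs (Re (s - (x, y))) + Rabs (Im (s - (x, y))) <= e + e by apply: Rplus_le_compat.
      lra.
    rewrite Hgz in Hs.
    have := Rle_lt_trans _ _ _ (re_le_Cmod _) Hs; have := Rle_lt_trans _ _ _ (im_le_Cmod _) Hs.
    rewrite /Re /Im /= Ropp_0 Rplus_0_r => H3 /Rabs_lt_between H4; split; lra.
  (* The integrand on a side of the small square, up to orientation. Its numerator is at least
     [3 / 4 * e] and its denominator at most [2 * e ^ 2]; a lower bound [/ (4 * e)] on four sides of
     length [2 * e] gives the total 2. *)
  have Hkey : forall v g1 g2, x - e <= x + v <= x + e -> 7 / 8 <= g1 -> Rabs g2 <= / 8 ->
      / (4 * e) <= (g1 * e + g2 * v) / (e ^ 2 + v ^ 2).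
    move=> v g1 g2 Hv H1 /Rabs_le_between H2.
    have Hsq' : 0 < e ^ 2 + v ^ 2 by nra.
    apply (Rmult_le_reg_r (4 * e * (e ^ 2 + v ^ 2))); first nra.
    have -> : / (4 * e) * (4 * e * (e ^ 2 + v ^ 2)) = e ^ 2 + v ^ 2 by field; lra.
    have -> : (g1 * e + g2 * v) / (e ^ 2 + v ^ 2) * (4 * e * (e ^ 2 + v ^ 2)) = 4 * e * (g1 * e + g2 * v) by field; lra.
    have : - (e / 8) <= g2 * v.
      have := Rmult_le_compat_r (e + v) (- / 8) g2; have := Rmult_le_compat_r (e - v) g2 (/ 8); nra.
    have : v ^ 2 <= e ^ 2 by nra.
    nra.
  have Hne : forall a b, a <> x \/ b <> y -> (a, b) <> (x, y) by move=> a b Hab [? ?]; case: Hab.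
  have Hin : forall t, - e <= t <= e -> Rabs t <= e by move=> t Ht; apply/Rabs_le_between.
  have Hbot : forall a, x - e <= a <= x + e -> / (4 * e) <= Im (q (a, y - e)).
    move=> a Ha; rewrite /q; have [_ ->] := Cdiv_shift_Re_Im (g (a, y - e)) (a, y - e) (x, y) (Hne (a) (y - e) ltac:(lra)).
    have [H1 H2] := Hg1 (a, y - e) ltac:(apply: Hin => /=; lra) ltac:(apply: Hin => /=; lra).
    have := Hkey (a - x) _ _ ltac:(lra) H1 H2; congr (_ <= _ / _); rewrite [Re (a, _)]/= [Im (a, _)]/= [Re (x, _)]/= [Im (x, _)]/=; ring.
  have Htop : forall a, x - e <= a <= x + e -> Im (q (a, y + e)) <= - / (4 * e).
    move=> a Ha; rewrite /q; have [_ ->] := Cdiv_shift_Re_Im (g (a, y + e)) (a, y + e) (x, y) (Hne (a) (y + e) ltac:(lra)).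
    have [H1 H2] := Hg1 (a, y + e) ltac:(apply: Hin => /=; lra) ltac:(apply: Hin => /=; lra).
    rewrite -Rabs_Ropp in H2.
    have := Ropp_le_contravar _ _ (Hkey (a - x) _ _ ltac:(lra) H1 H2).
    rewrite -Rdiv_opp_l; congr (_ / _ <= _); rewrite [Re (a, _)]/= [Im (a, _)]/= [Re (x, _)]/= [Im (x, _)]/=; ring.
  have Hright : forall b, y - e <= b <= y + e -> / (4 * e) <= Re (q (x + e, b)).
    move=> b Hb; rewrite /q; have [-> _] := Cdiv_shift_Re_Im (g (x + e, b)) (x + e, b) (x, y) (Hne (x + e) (b) ltac:(lra)).
    have [H1 H2] := Hg1 (x + e, b) ltac:(apply: Hin => /=; lra) ltac:(apply: Hin => /=; lra).
    have := Hkey (b - y) _ _ ltac:(lra) H1 H2; congr (_ <= _ / _); rewrite [Re (x + e, _)]/= [Im (x + e, _)]/= [Re (x, _)]/= [Im (x, _)]/=; ring.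
  have Hleft : forall b, y - e <= b <= y + e -> Re (q (x - e, b)) <= - / (4 * e).
    move=> b Hb; rewrite /q; have [-> _] := Cdiv_shift_Re_Im (g (x - e, b)) (x - e, b) (x, y) (Hne (x - e) (b) ltac:(lra)).
    have [H1 H2] := Hg1 (x - e, b) ltac:(apply: Hin => /=; lra) ltac:(apply: Hin => /=; lra).
    rewrite -Rabs_Ropp in H2.
    have := Ropp_le_contravar _ _ (Hkey (b - y) _ _ ltac:(lra) H1 H2).
    rewrite -Rdiv_opp_l; congr (_ / _ <= _); rewrite [Re (x - e, _)]/= [Im (x - e, _)]/= [Re (x, _)]/= [Im (x, _)]/=; ring.
  have B1 := RInt_const_le (fun a => Im (q (a, y - e))) (x - e) (x + e) (/ (4 * e)) ltac:(lra)
    ltac:(by apply: ex_RInt_horizontal => [|a Ha]; [lra | apply: Hq1; lra]) Hbot.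
  have B2 := RInt_le_const (fun a => Im (q (a, y + e))) (x - e) (x + e) (- / (4 * e)) ltac:(lra)
    ltac:(by apply: ex_RInt_horizontal => [|a Ha]; [lra | apply: Hq1; lra]) Htop.
  have B3 := RInt_const_le (fun b => Re (q (x + e, b))) (y - e) (y + e) (/ (4 * e)) ltac:(lra)
    ltac:(by apply: ex_RInt_vertical => [|a Ha]; [lra | apply: Hq1; lra]) Hright.
  have B4 := RInt_le_const (fun b => Re (q (x - e, b))) (y - e) (y + e) (- / (4 * e)) ltac:(lra)
    ltac:(by apply: ex_RInt_vertical => [|a Ha]; [lra | apply: Hq1; lra]) Hleft.
  rewrite /contour_im.
  have E : / (4 * e) * (2 * e) = / 2 by field; lra.
  have E1 : x + e - (x - e) = 2 * e by ring.
  have E2 : y + e - (y - e) = 2 * e by ring.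
  rewrite !E1 in B1 B2; rewrite !E2 in B3 B4; lra.
lra.
Qed.

(** Dividing by [g z] reduces to the normalized case. The loss of a factor 4 is harmless, because
    the bounds it is applied to can be made arbitrarily small. *)
Lemma weak_maximum_principle (g : C -> C) (z : C) (r M : R) :
  0 < r -> holomorphic_on_square g z r ->
  (forall s, on_square_boundary z r s -> Cmod (g s) <= M) -> Cmod (g z) <= 4 * M.
Proof.
move=> Hr Hg HM.
have [Hz|Hz] := classic (g z = 0%C).
  rewrite Hz Cmod_0.
  have Hb : on_square_boundary z r (Re z + r, Im z).
    rewrite /on_square_boundary /=.
    have -> : Re z + r - Re z = r by ring.
    have -> : Im z - Im z = 0 by ring.
    rewrite Rabs_R0 Rabs_right; lra.
  have := HM _ Hb; have := Cmod_ge_0 (g (Re z + r, Im z)); lra.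
have Hp : 0 < Cmod (g z) by apply/Cmod_gt_0.
have H := weak_maximum_principle_normalized (fun s => g s * / g z)%C z r (M / Cmod (g z)) Hr.
have : / 4 <= M / Cmod (g z).
  apply: H.
  - by move=> a b Ha Hb; apply: holomorphic_at_mult; [exact: Hg | exact: holomorphic_at_const].
  - exact: Cinv_r.
  - move=> s Hs; rewrite Cmod_mult Cmod_inv //; apply: Rmult_le_compat_r; last exact: HM.
    by apply: Rlt_le; apply: Rinv_0_lt_compat.
move=> K; apply (Rmult_le_compat_r (4 * Cmod (g z))) in K; last lra.
have E : M / Cmod (g z) * (4 * Cmod (g z)) = 4 * M by field; lra.
lra.
Qed.

(** * Powers of integers *)

Lemma Cexp_plus (a b : C) : Cexp (a + b)%C = (Cexp a * Cexp b)%C.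
Proof.
case: a => a1 a2; case: b => b1 b2; rewrite /Cexp /Cmult /Cplus /Re /Im /=.
rewrite exp_plus cos_plus sin_plus; f_equal; ring.
Qed.

Lemma Cexp_0 : Cexp 0%C = 1%C.
Proof. by rewrite /Cexp /= exp_0 cos_0 sin_0 !Rmult_1_l. Qed.

Lemma Cexp_RtoC (x : R) : Cexp (RtoC x) = RtoC (exp x).
Proof. by rewrite /Cexp /RtoC /= cos_0 sin_0 Rmult_1_r Rmult_0_r. Qed.

Lemma Cmod_Cexp (z : C) : Cmod (Cexp z) = exp (Re z).
Proof.
case: z => a b; have Hp := exp_pos a; rewrite /Cexp [Re (a, b)]/= [Im (a, b)]/=.
rewrite /Cmod /= -(sqrt_Rsqr (exp a)); last lra.
f_equal; rewrite /Rsqr sqrt_square; last lra.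
have Hsc := sin2_cos2 b; rewrite /Rsqr in Hsc.
have -> : exp a * exp a = exp a * exp a * (sin b * sin b + cos b * cos b) by rewrite Hsc; ring.
ring.
Qed.

Lemma Cexp_conj (z : C) : Cconj (Cexp z) = Cexp (Cconj z).
Proof. by rewrite /Cexp /Cconj /= cos_neg sin_neg Ropp_mult_distr_r. Qed.

Lemma exp_monotone (x y : R) : x <= y -> exp x <= exp y.
Proof. by move=> [H|->]; [apply: Rlt_le; exact: exp_increasing | exact: Rle_refl]. Qed.

(** Both signs of [a] follow from [1 + x <= exp x] at [a] and at [- a]. *)
Lemma exp_sub_1_bound (a : R) : Rabs (exp a - 1) <= Rabs a * exp (Rabs a).
Proof.
have H1 := exp_ineq1_le a; have H2 := exp_ineq1_le (- a).
have He : exp a * exp (- a) = 1 by rewrite -exp_plus Rplus_opp_r exp_0.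
have Hp := exp_pos a; have Hp' := exp_pos (- a).
have [Ha|Ha] := Rle_lt_dec 0 a.
- rewrite (Rabs_right a); last lra. rewrite Rabs_right; last lra; nra.
- rewrite (Rabs_left a) //. rewrite Rabs_left1; first nra.
  by have := exp_increasing _ _ Ha; rewrite exp_0; lra.
Qed.

Lemma exp_taylor1_bound (a : R) : Rabs (exp a - 1 - a) <= a ^ 2 * exp (Rabs a).
Proof.
have H1 := exp_ineq1_le a; have H2 := exp_ineq1_le (- a).
have He : exp a * exp (- a) = 1 by rewrite -exp_plus Rplus_opp_r exp_0.
have Hp := exp_pos a.
rewrite Rabs_right; last lra.
have H3 : exp a - 1 - a <= a * (exp a - 1) by nra.
apply: Rle_trans H3 _; apply: Rle_trans (Rle_abs _) _.
rewrite Rabs_mult -(pow2_abs a); have := exp_sub_1_bound a; have := Rabs_pos a; nra.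
Qed.

Lemma sin_abs_le (x : R) : Rabs (sin x) <= Rabs x.
Proof.
have Hpos : forall y, 0 < y -> Rabs (sin y) <= y.
  move=> y Hy; have := sin_lt_x y Hy; have := SIN_bound y => Hb Hs.
  apply/Rabs_le_between; split; last lra.
  have [H|H] := Rle_lt_dec y 1; last lra.
  have := sin_ge_0 y; have := PI2_1; lra.
have [H|[->|H]] := Rtotal_order x 0.
- by rewrite -(Rabs_Ropp (sin x)) -sin_neg (Rabs_left x) //; apply: Hpos; lra.
- by rewrite sin_0; apply: Rle_refl.
- by rewrite (Rabs_right x); [exact: Hpos | lra].
Qed.

Lemma cos_taylor_bound (b : R) : Rabs (cos b - 1) <= b ^ 2 / 2.
Proof.
have E : cos b = 1 - 2 * (sin (b / 2)) ^ 2.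
  by rewrite -{1}(Rmult_1_l b) (_ : 1 * b = 2 * (b / 2)); [rewrite cos_2a_sin; ring | field].
have H := sin_abs_le (b / 2).
have H2 : sin (b / 2) ^ 2 <= (b / 2) ^ 2.
  rewrite -(pow2_abs (sin _)) -(pow2_abs (b / 2)); apply: pow_incr; split => //; exact: Rabs_pos.
rewrite E Rabs_left1; have := pow2_ge_0 (sin (b / 2)); nra.
Qed.

Lemma sin_taylor_bound (b : R) : Rabs (sin b - b) <= b ^ 2.
Proof.
have Hpos : forall y, 0 < y -> Rabs (sin y - y) <= y ^ 2.
  move=> y Hy; have Hs := sin_lt_x y Hy.
  rewrite Rabs_left; last lra.
  have [c [Hc Hc']] := MVT_cor2 sin cos 0 y Hy (fun c _ => derivable_pt_lim_sin c).
  rewrite sin_0 in Hc.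
  have := cos_taylor_bound c; have := COS_bound c => Hb /Rabs_le_between Hb'.
  have : 1 - cos c <= c by have [?|?] := Rle_lt_dec c 2; nra.
  nra.
have [H|[->|H]] := Rtotal_order b 0.
- have -> : sin b - b = - (sin (- b) - (- b)) by rewrite sin_neg; ring.
  have -> : b ^ 2 = (- b) ^ 2 by ring.
  by rewrite Rabs_Ropp; apply: Hpos; lra.
- rewrite sin_0 Rminus_0_r Rabs_R0; lra.
- exact: Hpos.
Qed.

(** The real and imaginary parts are split into products of one-variable remainders of exp, cos and
    sin; the mixed term |a| |b| is absorbed by (a^2 + b^2) / 2. *)
Lemma Cexp_taylor1_bound (w : C) :
  Cmod (Cexp w - 1 - w) <= 2 * Cmod w ^ 2 * exp (Rabs (Re w)).
Proof.
rewrite Cmod2_alt; case: w => a b; apply: Rle_trans (Cmod_le_sum _) _.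
rewrite /Cexp /Re /Im /=.
have HE : 1 + Rabs a <= exp (Rabs a) by exact: exp_ineq1_le.
set E := exp (Rabs a) in HE *.
have Ha := Rabs_pos a; have Hb := Rabs_pos b.
have -> : exp a * cos b + - (1) + - a = (exp a - 1 - a) * cos b + (1 + a) * (cos b - 1) by ring.
have -> : exp a * sin b + - 0 + - b = (exp a - 1) * sin b + (sin b - b) by ring.
have B1 : Rabs ((exp a - 1 - a) * cos b) <= a ^ 2 * E.
  rewrite Rabs_mult; have := exp_taylor1_bound a; rewrite -/E.
  have : Rabs (cos b) <= 1 by apply/Rabs_le_between; exact: COS_bound.
  have := Rabs_pos (exp a - 1 - a); have := Rabs_pos (cos b); nra.
have B2 : Rabs ((1 + a) * (cos b - 1)) <= E * (b ^ 2 / 2).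
  rewrite Rabs_mult; apply: Rmult_le_compat; try exact: Rabs_pos; last exact: cos_taylor_bound.
  by apply: Rle_trans (Rabs_triang _ _) _; rewrite Rabs_R1.
have B3 : Rabs ((exp a - 1) * sin b) <= Rabs a * E * Rabs b.
  rewrite Rabs_mult; apply: Rmult_le_compat; try exact: Rabs_pos; [exact: exp_sub_1_bound | exact: sin_abs_le].
have B4 : Rabs (sin b - b) <= E * b ^ 2.
  have := sin_taylor_bound b; have := pow2_ge_0 b; nra.
have T1 := Rabs_triang ((exp a - 1 - a) * cos b) ((1 + a) * (cos b - 1)).
have T2 := Rabs_triang ((exp a - 1) * sin b) (sin b - b).
have H5 : Rabs a * Rabs b <= (a ^ 2 + b ^ 2) / 2.
  by rewrite -(pow2_abs a) -(pow2_abs b); have := pow2_ge_0 (Rabs a - Rabs b); nra.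
have H6 : E * (Rabs a * Rabs b) <= E * ((a ^ 2 + b ^ 2) / 2) by apply: Rmult_le_compat_l; lra.
have H7 : 0 <= E * a ^ 2 by have := pow2_ge_0 a; nra.
have H8 : 0 <= E * b ^ 2 by have := pow2_ge_0 b; nra.
nra.
Qed.

Lemma holomorphic_at_Cexp (p : C) : holomorphic_at Cexp p.
Proof.
exists (Cexp p) => eps Heps.
have Hp := exp_pos (Re p).
have Hk : 0 < eps / (6 * exp (Re p)) by apply: Rdiv_lt_0_compat; lra.
(* The 6 is the constant 2 of [Cexp_taylor1_bound] times exp 1 <= 3, the increment having modulus
   below 1. *)
exists (Rmin 1 (eps / (6 * exp (Re p)))); split; first by apply: Rmin_pos; lra.
move=> s Hs.
have H1 := Rlt_le_trans _ _ _ Hs (Rmin_l _ _).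
have H2 := Rlt_le_trans _ _ _ Hs (Rmin_r _ _).
have -> : (Cexp s - Cexp p - Cexp p * (s - p) = Cexp p * (Cexp (s - p) - 1 - (s - p)))%C.
  have {1}-> : (s = p + (s - p))%C by ring.
  by rewrite Cexp_plus; ring.
rewrite Cmod_mult Cmod_Cexp.
set h := (s - p)%C in H1 H2 *.
have Hh := Cmod_ge_0 h.
have K := Cexp_taylor1_bound h.
have He : exp (Rabs (Re h)) <= 3.
  apply: Rle_trans exp_le_3; apply: exp_monotone; have := re_le_Cmod h; lra.
have K2 : 2 * Cmod h ^ 2 * exp (Rabs (Re h)) <= 6 * Cmod h ^ 2.
  have := pow2_ge_0 (Cmod h); nra.
apply (Rle_trans _ (exp (Re p) * (6 * Cmod h ^ 2))); first by apply: Rmult_le_compat_l; lra.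
have E : eps = exp (Re p) * 6 * (eps / (6 * exp (Re p))) by field; lra.
set X := eps / _ in H2 E; rewrite E.
have : exp (Re p) * 6 * Cmod h <= exp (Re p) * 6 * X by apply: Rmult_le_compat_l; lra.
nra.
Qed.

Lemma nat_Cpower_plus (n : nat) (s t : C) :
  nat_Cpower n (s + t)%C = (nat_Cpower n s * nat_Cpower n t)%C.
Proof. by rewrite /nat_Cpower Cmult_plus_distr_r Cexp_plus. Qed.

Lemma nat_Cpower_mult (m n : nat) (s : C) : (0 < m)%nat -> (0 < n)%nat ->
  nat_Cpower (m * n) s = (nat_Cpower m s * nat_Cpower n s)%C.
Proof.
move=> Hm Hn; rewrite /nat_Cpower mult_INR ln_mult; try exact: lt_0_INR.
by rewrite RtoC_plus Cmult_plus_distr_l Cexp_plus.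
Qed.

Lemma nat_Cpower_1 (n : nat) : (0 < n)%nat -> nat_Cpower n 1%C = RtoC (INR n).
Proof. by move=> Hn; rewrite /nat_Cpower Cmult_1_l Cexp_RtoC exp_ln //; exact: lt_0_INR. Qed.

Lemma nat_Cpower_base1 (s : C) : nat_Cpower 1 s = 1%C.
Proof. by rewrite /nat_Cpower /= ln_1 Cmult_0_r Cexp_0. Qed.

Lemma Cmod_nat_Cpower (n : nat) (s : C) : Cmod (nat_Cpower n s) = Rpower (INR n) (Re s).
Proof. by rewrite /nat_Cpower Cmod_Cexp /Rpower /Re /RtoC /=; f_equal; ring. Qed.

Lemma nat_Cpower_conj (n : nat) (s : C) : Cconj (nat_Cpower n s) = nat_Cpower n (Cconj s).
Proof. by rewrite /nat_Cpower Cexp_conj Cmult_conj /RtoC /Cconj /= Ropp_0. Qed.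

Lemma holomorphic_at_nat_Cpower (n : nat) (f : C -> C) (p : C) :
  holomorphic_at f p -> holomorphic_at (fun s => nat_Cpower n (f s)) p.
Proof.
move=> Hf; apply: (holomorphic_at_comp Cexp (fun s => f s * RtoC (ln (INR n)))%C).
- exact: holomorphic_at_Cexp.
- by apply: holomorphic_at_mult => //; exact: holomorphic_at_const.
Qed.

Module ZeroDensity.

From mathcomp Require Import ssrfun ssrbool eqtype ssrnat seq div prime bigop.

(** * Approximation of zeta by its partial sums *)

(** These instances let the [bigop] lemmas (splitting, exchange, distributivity) apply to sums in
    [R] and [C]. *)
HB.instance Definition _ := Monoid.isComLaw.Build R 0 Rplus
  (fun x y z => esym (Rplus_assoc x y z)) Rplus_comm Rplus_0_l.
HB.instance Definition _ := Monoid.isMulLaw.Build R 0 Rmult Rmult_0_l Rmult_0_r.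
HB.instance Definition _ := Monoid.isAddLaw.Build R Rmult Rplus
  Rmult_plus_distr_r Rmult_plus_distr_l.
HB.instance Definition _ := Monoid.isComLaw.Build C (RtoC 0) Cplus
  Cplus_assoc Cplus_comm Cplus_0_l.
HB.instance Definition _ := Monoid.isMulLaw.Build C (RtoC 0) Cmult Cmult_0_l Cmult_0_r.
HB.instance Definition _ := Monoid.isAddLaw.Build C Cmult Cplus
  Cmult_plus_distr_r Cmult_plus_distr_l.

Notation "\rsum_ ( i <- r ) F" := (\big[Rplus/0]_(i <- r) F)
  (at level 36, i, r at level 50, F at level 36).
Notation "\rsum_ ( i <- r | P ) F" := (\big[Rplus/0]_(i <- r | P) F)
  (at level 36, i, r at level 50, F at level 36).
Notation "\csum_ ( i <- r ) F" := (\big[Cplus/RtoC 0]_(i <- r) F)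
  (at level 36, i, r at level 50, F at level 36).
Notation "\csum_ ( i <- r | P ) F" := (\big[Cplus/RtoC 0]_(i <- r | P) F)
  (at level 36, i, r at level 50, F at level 36).

Lemma rsum_le [I : eqType] (r : seq I) (F G : I -> R) :
  (forall i, i \in r -> F i <= G i) -> \rsum_(i <- r) F i <= \rsum_(i <- r) G i.
Proof.
move=> H; rewrite 2!big_seq; apply: (big_ind2 Rle) => //; first exact: Rle_refl.
by move=> *; apply: Rplus_le_compat.
Qed.

Lemma rsum_ge0 [I : Type] (r : seq I) (P : pred I) (F : I -> R) :
  (forall i, P i -> 0 <= F i) -> 0 <= \rsum_(i <- r | P i) F i.
Proof.
move=> H; apply: (big_ind (fun x => 0 <= x)) => //; first exact: Rle_refl.
by move=> *; apply: Rplus_le_le_0_compat.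
Qed.

Lemma Cmod_csum [I : Type] (r : seq I) (P : pred I) (F : I -> C) :
  Cmod (\csum_(i <- r | P i) F i) <= \rsum_(i <- r | P i) Cmod (F i).
Proof.
apply: (big_ind2 (fun z x => Cmod z <= x)) => [||i _]; [rewrite Cmod_0; exact: Rle_refl | | exact: Rle_refl].
by move=> z x w y Hz Hw; apply: Rle_trans (Cmod_triangle _ _) _; apply: Rplus_le_compat.
Qed.

Lemma RtoC_rsum [I : Type] (r : seq I) (P : pred I) (F : I -> R) :
  RtoC (\rsum_(i <- r | P i) F i) = \csum_(i <- r | P i) RtoC (F i).
Proof. by apply: (big_morph RtoC) => // x y; rewrite RtoC_plus. Qed.

Lemma Cconj_csum [I : Type] (r : seq I) (P : pred I) (F : I -> C) :
  Cconj (\csum_(i <- r | P i) F i) = \csum_(i <- r | P i) Cconj (F i).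
Proof.
apply: (big_morph Cconj) => [x y|]; first exact: Cplus_conj.
by rewrite /Cconj /RtoC /= Ropp_0.
Qed.

(** The second term is the integral of x^(-s) over [N, oo) when Re s > 1; it replaces the tail of
    the series and keeps a meaning for all s <> 1. *)
Definition zeta_approx (N : nat) (s : C) : C :=
  (\csum_(n <- index_iota 1 N.+1) nat_Cpower n (- s)
   + nat_Cpower N (1 - s) / (s - 1))%C.

Lemma ln_succ_div_bounds (n : nat) : (0 < n)%N ->
  / INR n.+1 <= ln (INR n.+1) - ln (INR n) <= / INR n.
Proof.
move=> /ltP Hn; have Hp : 0 < INR n by apply: lt_0_INR.
rewrite S_INR; set x := INR n in Hp *.
have H1 : 0 < x + 1 by lra.
rewrite -ln_div //; split.
- have := exp_ineq1_le (- ln ((x + 1) / x)).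
  rewrite exp_Ropp exp_ln; last by apply: Rdiv_lt_0_compat.
  have -> : / ((x + 1) / x) = 1 - / (x + 1) by field; lra.
  lra.
- have := exp_ineq1_le (ln ((x + 1) / x)).
  rewrite exp_ln; last by apply: Rdiv_lt_0_compat.
  have -> : (x + 1) / x = 1 + / x by field; lra.
  lra.
Qed.

Lemma csum_recr (F : nat -> C) (n : nat) :
  \csum_(k <- index_iota 1 n.+2) F k = (\csum_(k <- index_iota 1 n.+1) F k + F n.+1)%C.
Proof. by rewrite big_nat_recr. Qed.

(** With lam = log((n+1)/n), w = (s-1) lam and E = (n+1)^(1-s), the step equals E (1/(n+1) - lam -
    (exp w - 1 - w)/(s-1)). The bracket is O((1 + |s-1|) / n^2) and |E| <= sqrt(n+1) because Re s >=
    1/2. The resulting n^(-3/2) is majorized by a telescoping difference, so that summation over n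
    is immediate. *)
Lemma zeta_approx_step (n : nat) (s : C) : (0 < n)%N ->
  1 / 2 <= Re s <= 3 -> s <> 1%C ->
  Cmod (zeta_approx n.+1 s - zeta_approx n s)
    <= 40 * (1 + Cmod (s - 1)) * (/ sqrt (INR n) - / sqrt (INR n.+1)).
Proof.
move=> Hn Hs Hs1.
have [Hl1 Hl2] := ln_succ_div_bounds n Hn.
set lam := ln (INR n.+1) - ln (INR n) in Hl1 Hl2.
have Hp : 1 <= INR n by apply: (le_INR 1); apply/leP.
have HpS : INR n.+1 = INR n + 1 by rewrite S_INR.
have Hz : (s - 1 <> 0)%C by move=> H; apply: Hs1; rewrite -(Cplus_0_r 1%C) -H; ring.
have Hm : 0 < Cmod (s - 1) by apply/Cmod_gt_0.
pose E := nat_Cpower n.+1 (1 - s).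
pose w := ((s - 1) * RtoC lam)%C.
have E1 : nat_Cpower n.+1 (- s) = (E * RtoC (/ INR n.+1))%C.
  have -> : (- s = (1 - s) + - 1)%C by ring.
  rewrite nat_Cpower_plus -/E; congr (_ * _)%C.
  rewrite /nat_Cpower -RtoC_mult Cexp_RtoC; f_equal.
  have -> : -1 * ln (INR n.+1) = - ln (INR n.+1) by ring.
  by rewrite exp_Ropp exp_ln //; lra.
have E2 : nat_Cpower n (1 - s) = (E * Cexp w)%C.
  rewrite /E /nat_Cpower -Cexp_plus; f_equal; rewrite /w /lam RtoC_minus; ring.
have -> : (zeta_approx n.+1 s - zeta_approx n s
    = E * (RtoC (/ INR n.+1) - RtoC lam - (Cexp w - 1 - w) / (s - 1)))%C.
  rewrite /zeta_approx csum_recr E1 -/E E2 /w.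
  set S := \big[_/_]_(_ <= _ < _) _; set X := Cexp _; field; exact: Hz.
rewrite Cmod_mult.
set p := sqrt (INR n); set q := sqrt (INR n.+1).
have Hpp : p * p = INR n by apply: sqrt_sqrt; lra.
have Hqq : q * q = INR n + 1 by rewrite /q HpS; apply: sqrt_sqrt; lra.
have Hp1 : 1 <= p by rewrite -sqrt_1; apply: sqrt_le_1_alt.
have Hpq : p <= q by apply: sqrt_le_1_alt; lra.
have HE : Cmod E <= q.
  rewrite Cmod_nat_Cpower /q -Rpower_sqrt; last lra.
  apply: Rle_Rpower; first lra.
  rewrite /Re /=; rewrite /Re in Hs; lra.
have Hlam0 : 0 <= lam by apply: Rle_trans Hl1; apply: Rlt_le; apply: Rinv_0_lt_compat; lra.
have Hlam1 : lam <= 1.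
  by apply: Rle_trans Hl2 _; rewrite -Rinv_1; apply: Rinv_le_contravar; lra.
have Hrw : Rabs (Re w) <= 2 * lam.
  have -> : Re w = (Re s - 1) * lam by rewrite /w /Re /RtoC /=; ring.
  rewrite Rabs_mult (Rabs_right lam); last lra.
  by apply: Rmult_le_compat_r => //; apply/Rabs_le_between; lra.
have Hexp : exp (Rabs (Re w)) <= 4.
  have He : exp lam <= 2.
    have -> : exp lam = INR n.+1 / INR n.
      rewrite /lam /Rminus exp_plus exp_Ropp !exp_ln; try lra; by [].
    rewrite HpS; apply (Rmult_le_reg_r (INR n)); first lra.
    have -> : (INR n + 1) / INR n * INR n = INR n + 1 by field; lra.
    lra.
  apply (Rle_trans _ (exp (2 * lam))); first exact: exp_monotone.
  have -> : 2 * lam = lam + lam by ring.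
  rewrite exp_plus; have := exp_pos lam; nra.
have Hrem := Cexp_taylor1_bound w.
have Hw : Cmod w = Cmod (s - 1) * lam.
  by rewrite /w Cmod_mult Cmod_R Rabs_right //; lra.
have Hi : 0 < / INR n by apply: Rinv_0_lt_compat; lra.
have B1 : Cmod ((Cexp w - 1 - w) / (s - 1)) <= 8 * Cmod (s - 1) * (/ INR n) ^ 2.
  rewrite Cmod_div //; apply (Rmult_le_reg_r (Cmod (s - 1))) => //.
  have -> : Cmod (Cexp w - 1 - w) / Cmod (s - 1) * Cmod (s - 1) = Cmod (Cexp w - 1 - w) by field; lra.
  apply: Rle_trans Hrem _; rewrite Hw.
  have H1 : lam ^ 2 <= (/ INR n) ^ 2 by apply: pow_incr.
  have H2 : 2 * (Cmod (s - 1) * lam) ^ 2 * exp (Rabs (Re w)) <= 2 * (Cmod (s - 1) * lam) ^ 2 * 4.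
    apply: Rmult_le_compat_l => //; have := pow2_ge_0 (Cmod (s - 1) * lam); lra.
  have H3 : Cmod (s - 1) ^ 2 * lam ^ 2 <= Cmod (s - 1) ^ 2 * (/ INR n) ^ 2.
    by apply: Rmult_le_compat_l => //; exact: pow2_ge_0.
  rewrite Rpow_mult_distr in H2 *; lra.
have B2 : Cmod (RtoC (/ INR n.+1) - RtoC lam) <= (/ INR n) ^ 2.
  rewrite -RtoC_minus Cmod_R Rabs_left1; last lra.
  have : / INR n - / INR n.+1 <= (/ INR n) ^ 2.
    rewrite HpS.
    have -> : / INR n - / (INR n + 1) = / INR n * / (INR n + 1) by field; lra.
    rewrite /= Rmult_1_r; apply: Rmult_le_compat_l; first lra.
    apply: Rinv_le_contravar; lra.
  lra.
have B3 : Cmod (RtoC (/ INR n.+1) - RtoC lam - (Cexp w - 1 - w) / (s - 1))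
    <= 8 * (1 + Cmod (s - 1)) * (/ INR n) ^ 2.
  apply: Rle_trans (Cmod_triangle _ _) _; rewrite Cmod_opp.
  have := pow2_ge_0 (/ INR n); lra.
apply (Rle_trans _ (q * (8 * (1 + Cmod (s - 1)) * (/ INR n) ^ 2))).
  apply: Rmult_le_compat => //; exact: Cmod_ge_0.
(* Since q^2 - p^2 = 1, the difference on the right is 1 / (p q (p + q)). The 40 of the statement is
   this 5 times the 8 of [B3]. *)
have K : q * (/ INR n) ^ 2 <= 5 * (/ p - / q).
  have Hd : / p - / q = / (p * q * (p + q)).
    have -> : / p - / q = (q - p) / (p * q) by field; lra.
    have -> : q - p = / (p + q).
      apply (Rmult_eq_reg_r (p + q)); last lra.
      rewrite Rinv_l; last lra. nra.
    by field; nra.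
  rewrite Hd -Hpp.
  apply (Rmult_le_reg_r (p ^ 4 * (p * q * (p + q)))).
    by apply: Rmult_lt_0_compat; [apply: pow_lt; lra | repeat apply: Rmult_lt_0_compat; lra].
  have -> : q * (/ (p * p)) ^ 2 * (p ^ 4 * (p * q * (p + q))) = (q * q) * p * (p + q) by field; lra.
  have -> : 5 * / (p * q * (p + q)) * (p ^ 4 * (p * q * (p + q))) = 5 * p ^ 4 by field; nra.
  have H2 : q * q <= 2 * (p * p) by nra.
  have H3 : q <= 3 / 2 * p by nra.
  apply (Rle_trans _ ((2 * (p * p)) * p * (5 / 2 * p))); last by right; field.
  apply: Rmult_le_compat; try nra.
have : 8 * (1 + Cmod (s - 1)) * (q * (/ INR n) ^ 2) <= 8 * (1 + Cmod (s - 1)) * (5 * (/ p - / q)).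
  apply: Rmult_le_compat_l; lra.
lra.
Qed.

Lemma zeta_approx_dist (N M : nat) (s : C) : (0 < N <= M)%N ->
  1 / 2 <= Re s <= 3 -> s <> 1%C ->
  Cmod (zeta_approx M s - zeta_approx N s) <= 40 * (1 + Cmod (s - 1)) / sqrt (INR N).
Proof.
move=> /andP [HN /subnKC <-] Hs Hs1; set k := (M - N)%N.
have Hc : 0 <= 40 * (1 + Cmod (s - 1)) by have := Cmod_ge_0 (s - 1); lra.
have Hpos : forall n, (0 < n)%N -> 0 < / sqrt (INR n).
  by move=> n Hn; apply: Rinv_0_lt_compat; apply: sqrt_lt_R0; apply: lt_0_INR; apply/ltP.
apply (Rle_trans _ (40 * (1 + Cmod (s - 1)) * (/ sqrt (INR N) - / sqrt (INR (N + k))))); last first.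
  rewrite /Rdiv; apply: Rmult_le_compat_l => //.
  have := Hpos (N + k)%N ltac:(by rewrite addn_gt0 HN); lra.
elim: k => [|k IH].
  have -> : (zeta_approx (N + 0) s - zeta_approx N s = 0)%C by rewrite addn0; ring.
  rewrite addn0 Cmod_0; lra.
rewrite addnS.
have -> : (zeta_approx (N + k).+1 s - zeta_approx N s = (zeta_approx (N + k).+1 s - zeta_approx (N + k) s)
  + (zeta_approx (N + k) s - zeta_approx N s))%C by ring.
apply: Rle_trans (Cmod_triangle _ _) _.
have := zeta_approx_step (N + k) s ltac:(by rewrite addn_gt0 HN) Hs Hs1; lra.
Qed.

Lemma csum_sum_n (a : nat -> C) (n : nat) :
  sum_n a n = \csum_(k <- index_iota 1 n.+2) a k.-1.
Proof.
elim: n => [|n IH]; first by rewrite sum_O big_nat1.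
by rewrite sum_Sn IH (csum_recr _ n.+1).
Qed.

Lemma nat_Cpower_decay (z : C) (eps : R) : Re z < 0 -> 0 < eps ->
  exists M0 : nat, forall M, (M0 <= M)%N -> Cmod (nat_Cpower M z) < eps.
Proof.
move=> Hz Heps.
have [M0 HM0] := INR_unbounded (exp (/ (- Re z * eps))).
exists M0 => M /leP /le_INR HM.
rewrite Cmod_nat_Cpower /Rpower.
have Hp : 0 < / (- Re z * eps) by apply: Rinv_0_lt_compat; nra.
have HM1 : exp (/ (- Re z * eps)) < INR M by lra.
have HMp : 0 < INR M by have := exp_pos (/ (- Re z * eps)); lra.
have Hln : / (- Re z * eps) < ln (INR M).
  by rewrite -{1}(ln_exp (/ _)); apply: ln_increasing => //; exact: exp_pos.
have H1 := exp_ineq1_le (- Re z * ln (INR M)).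
have H2 : / eps < exp (- Re z * ln (INR M)).
  apply: Rlt_le_trans H1.
  have -> : / eps = - Re z * / (- Re z * eps) by field; lra.
  nra.
have -> : Re z * ln (INR M) = - (- Re z * ln (INR M)) by ring.
rewrite exp_Ropp -(Rinv_inv eps).
apply: Rinv_lt_contravar => //; apply: Rmult_lt_0_compat; last exact: exp_pos.
exact: Rinv_0_lt_compat.
Qed.

Lemma zeta_approx_cvg (zeta : C -> C) (s : C) (eps : R) :
  is_series (fun n : nat => nat_Cpower (S n) (- s)%C) (zeta s) ->
  1 < Re s -> 0 < eps ->
  exists M0 : nat, forall M, (M0 <= M)%N -> Cmod (zeta s - zeta_approx M s) < eps.
Proof.
move=> Hser Hs Heps.
have Hz : (s - 1 <> 0)%C.
  move=> H; have : Re (s - 1)%C = 0 by rewrite H.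
  by rewrite /Re /= ; rewrite /Re in Hs; lra.
have Hm : 0 < Cmod (s - 1) by apply/Cmod_gt_0.
have [M1 HM1] : exists M1 : nat, forall n, (M1 <= n)%coq_nat ->
    Cmod (sum_n (fun n : nat => nat_Cpower (S n) (- s)%C) n - zeta s) < eps / 2.
  apply: (Hser (fun z => Cmod (z - zeta s) < eps / 2)).
  apply/locally_C; apply: (locally_of_Cmod _ _ (eps / 2)); first lra.
  by move=> z.
have [M2 HM2] := nat_Cpower_decay (1 - s)%C (eps / 2 * Cmod (s - 1))
  ltac:(rewrite /Re /=; rewrite /Re in Hs; lra) ltac:(nra).
exists (maxn M1.+1 M2) => M; rewrite geq_max => /andP [H1 H2].
case: M H1 H2 => // M H1 H2.
rewrite /zeta_approx.
have := HM1 M ltac:(by apply/leP); rewrite csum_sum_n.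
have -> : \csum_(k <- index_iota 1 M.+2) nat_Cpower k.-1.+1 (- s)
    = \csum_(k <- index_iota 1 M.+2) nat_Cpower k (- s).
  by apply: eq_big_nat => k /andP [Hk _]; rewrite prednK.
set S := \csum_(_ <- _) _ => HS.
have -> : (zeta s - (S + nat_Cpower M.+1 (1 - s) / (s - 1))
  = - (S - zeta s) + - (nat_Cpower M.+1 (1 - s) / (s - 1)))%C by ring.
apply: Rle_lt_trans (Cmod_triangle _ _) _; rewrite !Cmod_opp Cmod_div //.
have : Cmod (nat_Cpower M.+1 (1 - s)) / Cmod (s - 1) < eps / 2.
  apply (Rmult_lt_reg_r (Cmod (s - 1))) => //.
  have -> : Cmod (nat_Cpower M.+1 (1 - s)) / Cmod (s - 1) * Cmod (s - 1) = Cmod (nat_Cpower M.+1 (1 - s)) by field; lra.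
  exact: HM2.
lra.
Qed.

Lemma Cmod_le_of_forall_eps (z : C) (x : R) : (forall eps, 0 < eps -> Cmod z <= x + eps) -> Cmod z <= x.
Proof. move=> H; apply: le_epsilon => eps Heps; exact: H. Qed.

(** [zeta_approx_dist] is uniform in [M], so the limit over [M] can be taken in it. *)
Lemma zeta_approx_error_right (zeta : C -> C) (N : nat) (s : C) :
  is_series (fun n : nat => nat_Cpower (S n) (- s)%C) (zeta s) ->
  (0 < N)%N -> 1 < Re s <= 3 ->
  Cmod (zeta s - zeta_approx N s) <= 40 * (1 + Cmod (s - 1)) / sqrt (INR N).
Proof.
move=> Hser HN Hs; apply: Cmod_le_of_forall_eps => eps Heps.
have [M0 HM0] := zeta_approx_cvg zeta s eps Hser ltac:(lra) Heps.
have Hs1 : s <> 1%C by move=> H; rewrite H /Re /= in Hs; lra.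
have := zeta_approx_dist N (maxn M0 N) s ltac:(by rewrite HN leq_maxr) ltac:(lra) Hs1.
have := HM0 (maxn M0 N) (leq_maxl _ _).
set F := zeta_approx (maxn M0 N) s => H1 H2.
have -> : (zeta s - zeta_approx N s = (zeta s - F) + (F - zeta_approx N s))%C by ring.
apply: Rle_trans (Cmod_triangle _ _) _; lra.
Qed.

Lemma holomorphic_at_zeta_approx (N : nat) (s : C) : s <> 1%C -> holomorphic_at (zeta_approx N) s.
Proof.
move=> Hs; apply: holomorphic_at_plus.
- elim: (index_iota 1 N.+1) => [|n l IH].
    apply: (holomorphic_at_ext (fun _ => RtoC 0)); last exact: holomorphic_at_const.
    by move=> z; rewrite big_nil.
  apply: (holomorphic_at_ext (fun z => nat_Cpower n (- z) + \csum_(k <- l) nat_Cpower k (- z))%C).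
    by move=> z; rewrite big_cons.
  apply: holomorphic_at_plus => //; apply: holomorphic_at_nat_Cpower.
  apply: holomorphic_at_opp; exact: holomorphic_at_id.
- apply: holomorphic_at_div_shift => //; apply: holomorphic_at_nat_Cpower.
  apply: holomorphic_at_minus; [exact: holomorphic_at_const | exact: holomorphic_at_id].
Qed.

(** Local bounds from continuity are glued by [rectangle_induction], whose splitting step takes the
    maximum over the quarters. *)
Lemma bounded_on_rectangle (f : C -> C) (a b c d : R) : a <= b -> c <= d ->
  holomorphic_on_rectangle f a b c d ->
  exists K, forall x y, a <= x <= b -> c <= y <= d -> Cmod (f (x, y)) <= K.
Proof.
move=> Hab Hcd Hf.
apply: (rectangle_induction (fun a b c d => exists K, forall x y, a <= x <= b -> c <= y <= d ->
  Cmod (f (x, y)) <= K)) => //.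
- move=> a' b' c' d' _ _ _ _ _ _ [K1 H1] [K2 H2] [K3 H3] [K4 H4].
  exists (Rmax (Rmax K1 K2) (Rmax K3 K4)) => x y Hx Hy.
  have L1 := Rmax_l (Rmax K1 K2) (Rmax K3 K4); have L2 := Rmax_r (Rmax K1 K2) (Rmax K3 K4).
  have L3 := Rmax_l K1 K2; have L4 := Rmax_r K1 K2.
  have L5 := Rmax_l K3 K4; have L6 := Rmax_r K3 K4.
  have [X|X] := Rle_lt_dec x ((a' + b') / 2); have [Y|Y] := Rle_lt_dec y ((c' + d') / 2).
  + have := H1 x y ltac:(lra) ltac:(lra); lra.
  + have := H3 x y ltac:(lra) ltac:(lra); lra.
  + have := H2 x y ltac:(lra) ltac:(lra); lra.
  + have := H4 x y ltac:(lra) ltac:(lra); lra.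
- move=> x y Hx Hy.
  have [delta [Hd H]] := holomorphic_at_continuous f (x, y) 1 (Hf x y Hx Hy) Rlt_0_1.
  exists (delta / 2); split; first lra.
  move=> a' b' c' d' Ha Hb Hc Hd' Hw Hh; exists (Cmod (f (x, y)) + 1) => x' y' Hx' Hy'.
  have : Cmod (f (x', y') - f (x, y)) < 1.
    apply: H; apply: Rle_lt_trans (Cmod_le_sum _) _; rewrite /=.
    have : Rabs (x' + - x) <= b' - a' by apply/Rabs_le_between; lra.
    have : Rabs (y' + - y) <= d' - c' by apply/Rabs_le_between; lra.
    lra.
  have := Cmod_triangle (f (x', y') - f (x, y)) (f (x, y)).
  have -> : (f (x', y') - f (x, y) + f (x, y) = f (x', y'))%C by ring.
  lra.
Qed.

(* The weight [exp (k (5 w / 16 + w ^ 2))], [w = s - z], is at most [exp (- k / 64)]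
   on the part [Re w <= 1 / 10] of the boundary of the square [|Re w|, |Im w| <= 1 / 4]. *)
Definition transfer_weight (k : R) (z s : C) : C :=
  Cexp (RtoC k * (RtoC (5 / 16) * (s - z) + (s - z) * (s - z)))%C.

Lemma Cmod_transfer_weight (k : R) (z s : C) :
  Cmod (transfer_weight k z s)
    = exp (k * (5 / 16 * (Re s - Re z) + (Re s - Re z) ^ 2 - (Im s - Im z) ^ 2)).
Proof.
rewrite /transfer_weight Cmod_Cexp; f_equal.
by case: s => s1 s2; case: z => z1 z2; rewrite /Re /Im /=; ring.
Qed.

Lemma transfer_weight_center (k : R) (z : C) : transfer_weight k z z = 1%C.
Proof.
rewrite /transfer_weight (_ : (_ * _ = 0)%C) ?Cexp_0 //; ring.
Qed.

Lemma holomorphic_at_transfer_weight (k : R) (z s : C) : holomorphic_at (transfer_weight k z) s.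
Proof.
apply: (holomorphic_at_comp Cexp); first exact: holomorphic_at_Cexp.
have H : holomorphic_at (fun t => t - z)%C s.
  apply: holomorphic_at_minus; [exact: holomorphic_at_id | exact: holomorphic_at_const].
apply: holomorphic_at_mult; first exact: holomorphic_at_const.
apply: holomorphic_at_plus; apply: holomorphic_at_mult => //; exact: holomorphic_at_const.
Qed.

(** The threshold 1/10 is 1 - 9/10: when Re z >= 9/10, every boundary point with Re s <= 1 satisfies
    it. With u, v the real and imaginary parts of s - z, the exponent is k (5 u / 16 + u^2 - v^2):
    on the left side u = -1/4 the linear term outweighs u^2, and on the horizontal sides -v^2 =
    -1/16 outweighs the rest. *)
Lemma transfer_weight_le (k : R) (z s : C) : 0 <= k -> on_square_boundary z (/ 4) s ->
  Cmod (transfer_weight k z s) <= exp k /\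
  (Re s - Re z <= / 10 -> Cmod (transfer_weight k z s) <= exp (- (k / 64))).
Proof.
rewrite Cmod_transfer_weight /on_square_boundary; set u := Re s - Re z; set v := Im s - Im z.
move=> Hk [/Rabs_le_between [Hu1 Hu2] [/Rabs_le_between [Hv1 Hv2] Huv]].
have Hv0 := pow2_ge_0 v.
split; [|move=> Hu]; apply: exp_monotone.
- have Hu3 : u ^ 2 <= / 16 by nra.
  rewrite -[X in _ <= X]Rmult_1_r; apply: Rmult_le_compat_l; lra.
- have : 5 / 16 * u + u ^ 2 - v ^ 2 <= - / 64.
    case: Huv => H.
      have -> : u = - / 4 by have [h|h] := Rle_lt_dec 0 u; [move: H; rewrite Rabs_right; lra | move: H; rewrite Rabs_left; lra].
      lra.
    have -> : v ^ 2 = / 16 by rewrite -(pow2_abs v) H; field.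
    have : (u + / 4) * (/ 10 - u) >= 0 by apply: Rle_ge; apply: Rmult_le_pos; lra.
    lra.
  move=> H; apply (Rle_trans _ (k * (- / 64))); [apply: Rmult_le_compat_l; lra | lra].
Qed.

(** The weight equals 1 at the centre, so the maximum principle bounds the unweighted error there.
    On the boundary with Re s <= 1 the error is only bounded, uniformly in [M], but the weight is
    tiny; on the rest the weight may be as large as exp k, but the error decays like 1 / sqrt M.
    Hence [k] is chosen first and [M] afterwards. *)
Lemma zeta_approx_cvg_left (zeta : C -> C) (z : C) (eps : R) :
  is_riemann_zeta zeta -> 9 / 10 <= Re z <= 1 -> 2 <= Im z -> 0 < eps ->
  exists M0 : nat, forall M, (M0 <= M)%N -> Cmod (zeta z - zeta_approx M z) <= eps.
Proof.
move=> [Hser Hder] Hre Him Heps.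
have Hne : forall s : C, 1 <= Im s -> s <> 1%C by move=> s Hs H; rewrite H /Im /= in Hs; lra.
have Hholo : forall s : C, 1 <= Im s -> holomorphic_at zeta s.
  by move=> s Hs; apply: holomorphic_at_ex_derive; apply: Hder; exact: Hne.
have [K HK] : exists K, forall x y, Re z - / 4 <= x <= Re z + / 4 -> Im z - / 4 <= y <= Im z + / 4 ->
    Cmod (zeta (x, y)) <= K.
  apply: bounded_on_rectangle; try lra.
  by move=> x y Hx Hy; apply: Hholo => /=; lra.
pose D := Cmod (z - 1) + 1.
have HD : 1 <= D by have := Cmod_ge_0 (z - 1); rewrite /D; lra.
have Hsq : forall s, on_square_boundary z (/ 4) s ->
    1 <= Im s /\ 1 / 2 <= Re s <= 3 /\ Cmod (s - 1) <= D /\ Cmod (zeta s) <= K.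
  move=> s [/Rabs_le_between Hu [/Rabs_le_between Hv _]]; repeat split; try lra.
    have -> : (s - 1 = (z - 1) + (s - z))%C by ring.
    apply: Rle_trans (Cmod_triangle _ _) _; apply: Rplus_le_compat_l.
    apply: Rle_trans (Cmod_le_sum _) _.
    have : Rabs (Re (s - z)) <= / 4 by apply/Rabs_le_between.
    have : Rabs (Im (s - z)) <= / 4 by apply/Rabs_le_between.
    lra.
  by rewrite [s]surjective_pairing; apply: HK; rewrite -/(Re s) -/(Im s); lra.
(* Bound for the error on the part Re s <= 1: [K] for zeta, 2 for [zeta_approx 1], and the rest for
   the distance from [zeta_approx 1] to [zeta_approx M]. *)
pose K' := K + 2 + 40 * (1 + D).
have HK0 : 0 <= K.
  have := HK (Re z) (Im z) ltac:(lra) ltac:(lra); have := Cmod_ge_0 (zeta (Re z, Im z)); lra.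
have HK' : 0 < K' by rewrite /K'; lra.
(* Then 4 K' exp(-k/64) <= eps, by x <= exp x at x = 4 K' / eps. *)
pose k := 64 * (4 * K' / eps).
have Hk : 0 <= k by rewrite /k; apply: Rmult_le_pos; [lra | apply: Rlt_le; apply: Rdiv_lt_0_compat; lra].
have Hk1 : 4 * (K' * exp (- (k / 64))) <= eps.
  have -> : k / 64 = 4 * K' / eps by rewrite /k; field; lra.
  have Hx := exp_ineq1_le (4 * K' / eps); have Hp := exp_pos (4 * K' / eps).
  rewrite exp_Ropp; apply (Rmult_le_reg_r (exp (4 * K' / eps))) => //.
  have -> : 4 * (K' * / exp (4 * K' / eps)) * exp (4 * K' / eps) = eps * (4 * K' / eps) by field; lra.
  apply: Rmult_le_compat_l; lra.
have [M0 HM0] := INR_unbounded ((160 * (1 + D) * exp k / eps) ^ 2).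
exists (maxn 1 M0) => M; rewrite geq_max => /andP [HM1 HM2].
have HMr : (160 * (1 + D) * exp k / eps) ^ 2 <= INR M.
  by have := le_INR _ _ (elimT leP HM2); lra.
have Hek := exp_pos k.
have HX : 0 < 160 * (1 + D) * exp k / eps by apply: Rdiv_lt_0_compat => //; nra.
have HMs : 160 * (1 + D) * exp k / eps <= sqrt (INR M).
  by rewrite -(sqrt_pow2 (160 * (1 + D) * exp k / eps)); [apply: sqrt_le_1_alt | lra].
have Hfin : 4 * (40 * (1 + D) / sqrt (INR M) * exp k) <= eps.
  have Hs : 0 < sqrt (INR M) by lra.
  apply (Rmult_le_reg_r (sqrt (INR M))) => //.
  have -> : 4 * (40 * (1 + D) / sqrt (INR M) * exp k) * sqrt (INR M) = eps * (160 * (1 + D) * exp k / eps).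
    by field; lra.
  by apply: Rmult_le_compat_l; lra.
have -> : (zeta z - zeta_approx M z = (zeta z - zeta_approx M z) * transfer_weight k z z)%C.
  by rewrite transfer_weight_center; ring.
apply (Rle_trans _ (4 * Rmax (K' * exp (- (k / 64))) (40 * (1 + D) / sqrt (INR M) * exp k))); last first.
  by rewrite /Rmax; case: Rle_dec.
apply: (weak_maximum_principle (fun s => (zeta s - zeta_approx M s) * transfer_weight k z s)%C _ (/ 4)); first lra.
  move=> x y Hx Hy; apply: holomorphic_at_mult; last exact: holomorphic_at_transfer_weight.
  by apply: holomorphic_at_minus; [apply: Hholo => /=; lra | apply: holomorphic_at_zeta_approx; apply: Hne => /=; lra].
move=> s Hs; rewrite Cmod_mult.
have [Hw1 Hw2] := transfer_weight_le k z s Hk Hs.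
have [Hs1 [Hs2 [Hs3 Hs4]]] := Hsq s Hs.
have HsqM : 0 < sqrt (INR M) by lra.
have [H1|H1] := Rle_lt_dec (Re s) 1.
- apply: Rle_trans (Rmax_l _ _).
  apply: Rmult_le_compat; try exact: Cmod_ge_0; last by apply: Hw2; lra.
  (* Comparing with length 1, where the approximation is 1 + 1/(s-1), makes the bound independent of
     [M]. *)
  have HF := zeta_approx_dist 1 M s ltac:(by rewrite HM1) Hs2 (Hne s Hs1).
  rewrite sqrt_1 in HF.
  have HF1 : Cmod (zeta_approx 1 s) <= 2.
    rewrite /zeta_approx big_nat1 !nat_Cpower_base1.
    have Hm : 1 <= Cmod (s - 1).
      apply: Rle_trans (im_le_Cmod _); apply: Rle_trans (Rle_abs _).
      by rewrite /Im /=; rewrite /Im in Hs1; lra.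
    apply: Rle_trans (Cmod_triangle _ _) _; rewrite Cmod_div; last by apply/Cmod_gt_0; lra.
    rewrite Cmod_1.
    have : 1 / Cmod (s - 1) <= 1 by apply (Rmult_le_reg_r (Cmod (s - 1))); [lra | field_simplify; lra].
    lra.
  have -> : (zeta s - zeta_approx M s = zeta s + (- zeta_approx 1 s + - (zeta_approx M s - zeta_approx 1 s)))%C by ring.
  apply: Rle_trans (Cmod_triangle _ _) _.
  have := Cmod_triangle (- zeta_approx 1 s) (- (zeta_approx M s - zeta_approx 1 s)).
  rewrite !Cmod_opp /K'; lra.
- apply: Rle_trans (Rmax_r _ _).
  apply: Rmult_le_compat => //; try exact: Cmod_ge_0.
  apply: Rle_trans (zeta_approx_error_right zeta M s _ _ _) _; [exact: Hser | by [] | lra |].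
  rewrite /Rdiv; apply: Rmult_le_compat_r; last lra.
  by apply: Rlt_le; apply: Rinv_0_lt_compat.
Qed.

(** To the left of the line convergence without a rate is enough: the rate is supplied by
    [zeta_approx_dist], as [M] tends to infinity. *)
Lemma zeta_approx_error (zeta : C -> C) (N : nat) (s : C) :
  is_riemann_zeta zeta -> (0 < N)%N -> 9 / 10 <= Re s <= 3 -> 2 <= Im s ->
  Cmod (zeta s - zeta_approx N s) <= 40 * (1 + Cmod (s - 1)) / sqrt (INR N).
Proof.
move=> Hzeta HN Hre Him.
have [H1|H1] := Rle_lt_dec (Re s) 1; last first.
  by apply: zeta_approx_error_right => //; [apply Hzeta | lra].
apply: Cmod_le_of_forall_eps => eps Heps.
have [M0 HM0] := zeta_approx_cvg_left zeta s eps Hzeta ltac:(lra) Him Heps.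
have Hs1 : s <> 1%C by move=> H; rewrite H /Im /= in Him; lra.
have := zeta_approx_dist N (maxn M0 N) s ltac:(by rewrite HN leq_maxr) ltac:(lra) Hs1.
have := HM0 (maxn M0 N) (leq_maxl _ _).
set F := zeta_approx (maxn M0 N) s => H2 H3.
have -> : (zeta s - zeta_approx N s = (zeta s - F) + (F - zeta_approx N s))%C by ring.
apply: Rle_trans (Cmod_triangle _ _) _; lra.
Qed.

(** The terms n >= 2 sum to at most 3/4 in modulus and cannot cancel the first term 1. This disposes
    of large sigma, the zero detection being done for Re s <= 2 only. *)
Lemma zeta_neq0_right (zeta : C -> C) (s : C) :
  is_series (fun n : nat => nat_Cpower (S n) (- s)%C) (zeta s) -> 2 <= Re s -> zeta s <> 0%C.
Proof.
move=> Hser Hs Hz.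
(* The term 1/4 is kept, and 1/k^2 <= 1/(k-1) - 1/k telescopes from k = 3 on, which gives 1/4 + 1/2
   - 1/(n+2). *)
have Hsq : forall n, \rsum_(k <- index_iota 2 n.+3) / INR k ^ 2 <= 3 / 4 - / INR n.+2.
  elim=> [|n IH]; first by rewrite big_nat1 /=; lra.
  rewrite big_nat_recr //; apply (Rle_trans _ (3 / 4 - / INR n.+2 + / INR n.+3 ^ 2)).
    exact: Rplus_le_compat_r.
  have Hp : 0 < INR n.+2 by apply: lt_0_INR; apply/ltP.
  rewrite (S_INR n.+2).
  have -> : / INR n.+2 = / (INR n.+2 + 1) + / (INR n.+2 * (INR n.+2 + 1)) by field; lra.
  have : / (INR n.+2 + 1) ^ 2 <= / (INR n.+2 * (INR n.+2 + 1)) by apply: Rinv_le_contravar; nra.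
  lra.
have Htail : forall n, Cmod (\csum_(k <- index_iota 2 n.+3) nat_Cpower k (- s)) <= 3 / 4.
  move=> n; apply: Rle_trans (Cmod_csum _ _ _) _.
  apply (Rle_trans _ (\rsum_(k <- index_iota 2 n.+3) / INR k ^ 2)).
    apply: rsum_le => k; rewrite mem_index_iota => /andP [Hk _].
    have Hk2 : 2 <= INR k by apply: (le_INR 2); apply/leP.
    rewrite Cmod_nat_Cpower -Rpower_pow; last lra.
    rewrite -Rpower_Ropp; apply: Rle_Rpower; first lra.
    by move: Hs; rewrite /Re /=; lra.
  have : 0 < / INR n.+2 by apply: Rinv_0_lt_compat; apply: lt_0_INR; apply/ltP.
  have := Hsq n; lra.
have [M1 HM1] : exists M1 : nat, forall n, (M1 <= n)%coq_nat ->
    Cmod (sum_n (fun n : nat => nat_Cpower (S n) (- s)%C) n - zeta s) < / 4.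
  apply: (Hser (fun z => Cmod (z - zeta s) < / 4)).
  apply/locally_C; apply: (locally_of_Cmod _ _ (/ 4)); first lra.
  by move=> z.
have := HM1 M1.+1 ltac:(by apply/leP); rewrite csum_sum_n Hz big_ltn // nat_Cpower_base1.
set T := \big[_/_]_(_ <= _ < _) _.
have HT : Cmod T <= 3 / 4.
  have <- : \csum_(k <- index_iota 2 M1.+3) nat_Cpower k (- s) = T; last exact: Htail.
  by apply: eq_big_nat => k /andP [Hk _]; rewrite prednK // (leq_trans _ Hk).
have := Cmod_triangle (1 + T - 0) (- T).
rewrite Cmod_opp (_ : (1 + T - 0 + - T = 1)%C); last ring.
rewrite Cmod_1 => H1 H2.
have H3 : Cmod (1 + T - 0) < / 4 by exact: H2.
lra.
Qed.

(** * The mollifier *)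

(** Removes the least prime factor, changing the sign, and returns 0 if that prime divides the
    cofactor. Each call decreases [n], so [n] itself is enough fuel. *)
Fixpoint mobius_rec (fuel n : nat) : R :=
  if fuel is fuel'.+1 then
    if (n <= 1)%N then 1
    else let p := pdiv n in
         if (p %| n %/ p)%N then 0 else - mobius_rec fuel' (n %/ p)
  else 0.

Definition mobius (n : nat) : R := mobius_rec n n.

Lemma div_pdiv_lt (n : nat) : (1 < n)%N -> (0 < n %/ pdiv n < n)%N.
Proof.
move=> Hn; have Hp := prime_gt1 (pdiv_prime Hn).
have Hn0 := ltnW Hn.
by rewrite ltn_Pdiv // divn_gt0 ?pdiv_leq // ltnW.
Qed.

Lemma mobius_recE (fuel n : nat) : (0 < n <= fuel)%N -> mobius_rec fuel n = mobius n.
Proof.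
have H : forall k m, (0 < n <= k)%N -> (0 < n <= m)%N -> mobius_rec k n = mobius_rec m n.
  elim/ltn_ind: n => n IH [|k] [|m]; try by case: n IH.
  move=> Hk Hm /=; case: leqP => // Hn.
  case: ifP => // _; congr (- _).
  have /andP [H1 H2] := div_pdiv_lt n Hn.
  case/andP: Hk => _ Hk; case/andP: Hm => _ Hm.
  by apply: IH => //; rewrite H1 -ltnS (leq_trans H2).
by move=> Hn; apply: H => //; case/andP: Hn => -> /=.
Qed.

Lemma mobius_1 : mobius 1 = 1.
Proof. by []. Qed.

Lemma mobius_gt1 (n : nat) : (1 < n)%N ->
  mobius n = if (pdiv n %| n %/ pdiv n)%N then 0 else - mobius (n %/ pdiv n).
Proof.
move=> Hn; have /andP [H1 H2] := div_pdiv_lt n Hn.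
case: n Hn H1 H2 => // n Hn H1 H2.
rewrite {1}/mobius /= leqNgt Hn /=; case: ifP => // _; congr (- _).
by apply: mobius_recE; rewrite H1 -ltnS.
Qed.

Lemma mobius_bound (n : nat) : (0 < n)%N -> Rabs (mobius n) <= 1.
Proof.
elim/ltn_ind: n => n IH Hn.
have [Hn1|Hn1] := ltnP 1 n.
  rewrite mobius_gt1 //; case: ifP => _; first by rewrite Rabs_R0; lra.
  by rewrite Rabs_Ropp; have /andP [H1 H2] := div_pdiv_lt n Hn1; apply: IH.
have -> : n = 1%N by apply/eqP; rewrite eqn_leq Hn1 Hn.
rewrite mobius_1 Rabs_R1; lra.
Qed.

Lemma rsum_opp [I : Type] (r : seq I) (P : pred I) (F : I -> R) :
  \rsum_(i <- r | P i) - F i = - \rsum_(i <- r | P i) F i.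
Proof. by symmetry; apply: (big_morph Ropp) => [x y|]; lra. Qed.

(* With [p] the least prime factor of [n], the divisors [p e] and [e] of [n],
   where [p] does not divide [e], cancel. *)
Lemma mobius_sum_divisors (n : nat) : (1 < n)%N -> \rsum_(d <- divisors n) mobius d = 0.
Proof.
move=> Hn; have Hn0 := ltnW Hn; set p := pdiv n.
have Hp : prime p by exact: pdiv_prime.
have Hp0 := prime_gt0 Hp.
rewrite (bigID (fun d => p %| d)%N) /=.
have -> : \rsum_(d <- divisors n | (p %| d)%N) mobius d
    = \rsum_(d <- divisors n | (p %| d)%N && ~~ (p %| d %/ p)%N) - mobius (d %/ p).
  rewrite [LHS](bigID (fun d => p %| d %/ p)%N) /=.
  have Hmu : forall d, d \in divisors n -> (p %| d)%N ->
      mobius d = if (p %| d %/ p)%N then 0 else - mobius (d %/ p).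
    move=> d; rewrite -dvdn_divisors // => Hd Hpd.
    have Hd0 : (0 < d)%N by exact: dvdn_gt0 Hd.
    have Hd1 : (1 < d)%N by apply: leq_trans (prime_gt1 Hp) (dvdn_leq _ _).
    have Hpd' : pdiv d = p.
      apply/eqP; rewrite eqn_leq pdiv_min_dvd ?prime_gt1 //=.
      by apply: pdiv_min_dvd; [exact: prime_gt1 (pdiv_prime Hd1) | exact: dvdn_trans (pdiv_dvd d) Hd].
    by rewrite mobius_gt1 // Hpd'.
  rewrite [X in Rplus X _]big_seq_cond [X in Rplus X _]big1; last first.
    by move=> d /andP [Hd /andP [Hpd Hpd']]; rewrite Hmu // Hpd'.
  rewrite Rplus_0_l big_seq_cond [RHS]big_seq_cond; apply: eq_bigr => d /andP [Hd /andP [Hpd Hpd']].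
  by rewrite Hmu // (negbTE Hpd').
rewrite rsum_opp -big_filter.
(* The surviving divisors are exactly the products p e with e a divisor of n prime to p; coprimality
   is what makes p e divide n. *)
have Hperm : perm_eq [seq d <- divisors n | (p %| d)%N && ~~ (p %| d %/ p)%N]
    [seq (p * e)%N | e <- divisors n & ~~ (p %| e)%N].
  apply: uniq_perm.
  - by rewrite filter_uniq // divisors_uniq.
  - by rewrite map_inj_uniq ?filter_uniq ?divisors_uniq // => x y /eqP; rewrite eqn_pmul2l // => /eqP.
  move=> d; rewrite mem_filter -dvdn_divisors //; apply/idP/mapP.
    move=> /andP [/andP [Hpd Hpd'] Hd]; exists (d %/ p)%N; last by rewrite mulnC divnK.
    rewrite mem_filter Hpd' -dvdn_divisors //=; apply: dvdn_trans Hd.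
    by apply/dvdnP; exists p; rewrite mulnC divnK.
  move=> [e]; rewrite mem_filter -dvdn_divisors // => /andP [Hpe He] ->.
  rewrite dvdn_mulr // mulKn // Hpe /= Gauss_dvd ?pdiv_dvd //.
  by rewrite prime_coprime.
rewrite (perm_big _ Hperm) /= big_map big_filter.
under eq_bigr => e _ do rewrite mulKn //.
by rewrite Rplus_opp_l.
Qed.

(** Reindexing by n = e k. It holds for any commutative monoid, and is used for complex sums in the
    mollifier identity and for real sums over divisors. *)
Lemma big_divisor_pairs (T : Type) (idx : T) (op : Monoid.com_law idx) (N M : nat)
    (F : nat -> nat -> T) :
  \big[op/idx]_(n <- index_iota 1 M.+1)
    \big[op/idx]_(e <- index_iota 1 N.+1 | (e %| n)%N && (n %/ e <= N)%N) F e (n %/ e)%N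
  = \big[op/idx]_(e <- index_iota 1 N.+1)
      \big[op/idx]_(k <- index_iota 1 N.+1 | (e * k <= M)%N) F e k.
Proof.
rewrite (exchange_big_dep xpredT) //= big_seq [RHS]big_seq; apply: eq_bigr => e.
rewrite mem_index_iota => /andP [He _].
rewrite -big_filter -[RHS]big_filter.
have Hperm : perm_eq [seq n <- index_iota 1 M.+1 | (e %| n)%N && (n %/ e <= N)%N]
    [seq (e * k)%N | k <- index_iota 1 N.+1 & (e * k <= M)%N].
  apply: uniq_perm.
  - by rewrite filter_uniq // iota_uniq.
  - by rewrite map_inj_uniq ?filter_uniq ?iota_uniq // => x y /eqP; rewrite eqn_pmul2l // => /eqP.
  move=> n; rewrite mem_filter mem_index_iota ltnS; apply/idP/mapP.
    move=> /andP [/andP [Hen HnN] /andP [Hn HnM]]; exists (n %/ e)%N; last by rewrite mulnC divnK.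
    rewrite mem_filter mem_index_iota ltnS HnN mulnC divnK // HnM /= andbT.
    by rewrite divn_gt0 // dvdn_leq.
  move=> [k]; rewrite mem_filter mem_index_iota ltnS => /andP [H1 /andP [Hk0 HkN]] ->.
  by rewrite dvdn_mulr // mulKn // HkN H1 muln_gt0 He Hk0.
rewrite (perm_big _ Hperm) /= big_map; apply: eq_bigr => k _.
by rewrite mulKn.
Qed.

Lemma perm_divisors (n N : nat) : (0 < n <= N)%N ->
  perm_eq [seq e <- index_iota 1 N.+1 | (e %| n)%N] (divisors n).
Proof.
move=> /andP [Hn HnN]; apply: uniq_perm; [by rewrite filter_uniq // iota_uniq | exact: divisors_uniq |].
move=> e; rewrite mem_filter mem_index_iota -dvdn_divisors // ltnS.
case He: (e %| n)%N => //=; rewrite (dvdn_gt0 Hn He) /=.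
by apply: leq_trans HnN; apply: dvdn_leq.
Qed.

(** The coefficient of n^(-s) in the product of the two sums of length [N]; the condition on
    [n %/ e] is the truncation of the second factor. *)
Definition mollified_coef (N n : nat) : R :=
  \rsum_(e <- index_iota 1 N.+1 | (e %| n)%N && (n %/ e <= N)%N) mobius e.

(** For n <= N neither truncation is felt, and the full divisor sum of the Mobius function
    remains. *)
Lemma mollified_coef_small (N n : nat) : (0 < n <= N)%N ->
  mollified_coef N n = if n == 1%N then 1 else 0.
Proof.
move=> HnN; rewrite /mollified_coef.
have -> : \rsum_(e <- index_iota 1 N.+1 | (e %| n)%N && (n %/ e <= N)%N) mobius e
    = \rsum_(e <- index_iota 1 N.+1 | (e %| n)%N) mobius e.
  apply: eq_bigl => e; rewrite (leq_trans (leq_div _ _)) ?andbT //; by case/andP: HnN.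
rewrite -big_filter (perm_big _ (perm_divisors _ _ HnN)) /=.
case/andP: HnN => Hn _; case: eqP => [->|/eqP Hn1]; first by rewrite big_seq1.
by apply: mobius_sum_divisors; rewrite ltn_neqAle eq_sym Hn1.
Qed.

Lemma rsum_const1 [I : Type] (r : seq I) : \rsum_(i <- r) 1 = INR (size r).
Proof. by elim: r => [|i r IH]; [rewrite big_nil | rewrite big_cons IH -[RHS]/(INR (size r).+1) S_INR Rplus_comm]. Qed.

Lemma divisor_count (n N : nat) : (0 < n <= N)%N ->
  \rsum_(e <- index_iota 1 N.+1 | (e %| n)%N) 1 = INR (size (divisors n)).
Proof. by move=> H; rewrite -big_filter (perm_big _ (perm_divisors _ _ H)) rsum_const1. Qed.

Lemma rsum_sub_le [I : eqType] (r : seq I) (P Q : pred I) (F : I -> R) :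
  (forall i, i \in r -> P i -> Q i) -> (forall i, Q i -> 0 <= F i) ->
  \rsum_(i <- r | P i) F i <= \rsum_(i <- r | Q i) F i.
Proof.
move=> HPQ HF; rewrite big_mkcond [X in _ <= X]big_mkcond; apply: rsum_le => i Hi.
case HP: (P i); first by rewrite HPQ //; exact: Rle_refl.
by case HQ: (Q i); [exact: HF | exact: Rle_refl].
Qed.

Lemma rsum_interval_le (a b c d : nat) (F : nat -> R) : (a <= b <= c)%N -> (c <= d)%N ->
  (forall n, (a <= n)%N -> 0 <= F n) ->
  \rsum_(n <- index_iota b c) F n <= \rsum_(n <- index_iota a d) F n.
Proof.
move=> /andP [Hab Hbc] Hcd HF.
have Hpos : forall m p, (a <= m)%N -> 0 <= \rsum_(n <- index_iota m p) F n.
  move=> m p Ham; rewrite big_seq_cond; apply: rsum_ge0 => n /andP [].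
  by rewrite mem_index_iota => /andP [Hn _] _; apply: HF; exact: leq_trans Hn.
rewrite (@big_cat_nat _ _ _ b a d) //; last exact: leq_trans Hcd.
rewrite (@big_cat_nat _ _ _ c b d) //.
have H1 := Hpos a b (leqnn a); have H2 := Hpos c d (leq_trans Hab Hbc).
set x := \big[_/_]_(_ <- index_iota a b) _ in H1 *; set y := \big[_/_]_(_ <- index_iota c d) _ in H2 *.
set z := \big[_/_]_(_ <- index_iota b c) _.
change (z <= x + (z + y)); lra.
Qed.

Lemma mollified_coef_bound (N n : nat) : (0 < n)%N ->
  Rabs (mollified_coef N n) <= INR (size (divisors n)).
Proof.
move=> Hn; rewrite /mollified_coef.
apply (Rle_trans _ (\rsum_(e <- index_iota 1 N.+1 | (e %| n)%N && (n %/ e <= N)%N) 1)).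
  rewrite big_seq_cond [X in _ <= X]big_seq_cond.
  apply: (big_ind2 (fun x y => Rabs x <= y)); first by rewrite Rabs_R0; exact: Rle_refl.
    move=> x y u v Hx Hu; apply: Rle_trans (Rabs_triang _ _) _; exact: Rplus_le_compat.
  move=> e /andP []; rewrite mem_index_iota => /andP [He _] _; exact: mobius_bound.
rewrite -big_filter rsum_const1; apply: le_INR; apply/leP.
apply: uniq_leq_size; first by rewrite filter_uniq // iota_uniq.
by move=> e; rewrite mem_filter -dvdn_divisors // => /andP [/andP [-> _] _].
Qed.

(** A divisor d of m k is the product of gcd(d, m), which divides m, and d / gcd(d, m), which
    divides k by Gauss's lemma. *)
Lemma divisors_mul_size (m k : nat) : (0 < m)%N -> (0 < k)%N ->
  (size (divisors (m * k)) <= size (divisors m) * size (divisors k))%N.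
Proof.
move=> Hm Hk.
rewrite -(size_allpairs muln); apply: uniq_leq_size; first exact: divisors_uniq.
move=> d; rewrite -dvdn_divisors ?muln_gt0 ?Hm ?Hk // => Hd.
have Hg : (0 < gcdn d m)%N by rewrite gcdn_gt0 Hm orbT.
apply/allpairsP; exists (gcdn d m, d %/ gcdn d m)%N; split => /=.
- by rewrite -dvdn_divisors // dvdn_gcdr.
- rewrite -dvdn_divisors //.
  have Hco : coprime (d %/ gcdn d m) (m %/ gcdn d m).
    rewrite /coprime -(eqn_pmul2r Hg) muln_gcdl !divnK ?dvdn_gcdl ?dvdn_gcdr //.
    by rewrite mul1n.
  rewrite -(Gauss_dvdr _ Hco) -(dvdn_pmul2r Hg) divnK ?dvdn_gcdl //.
  by rewrite -mulnA (mulnC k) mulnA divnK ?dvdn_gcdr.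
- by rewrite mulnC divnK // dvdn_gcdl.
Qed.

Definition harmonic (N : nat) : R := \rsum_(n <- index_iota 1 N.+1) / INR n.

Lemma INR_pos (n : nat) : (0 < n)%N -> 0 < INR n.
Proof. by move=> /ltP; exact: lt_0_INR. Qed.

Lemma harmonic_bound (N : nat) : (0 < N)%N -> harmonic N <= 1 + ln (INR N).
Proof.
elim: N => // [[|N] IH] _; first by rewrite /harmonic big_nat1 /= ln_1; lra.
rewrite /harmonic big_nat_recr //.
have [H1 _] := ln_succ_div_bounds N.+1 isT.
have := IH isT; rewrite /harmonic => H2.
apply (Rle_trans _ (1 + ln (INR N.+1) + / INR N.+2)); first exact: Rplus_le_compat_r.
lra.
Qed.

Lemma harmonic_ge0 (N : nat) : 0 <= harmonic N.
Proof.
rewrite /harmonic big_seq_cond; apply: rsum_ge0 => n /andP [].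
rewrite mem_index_iota => /andP [Hn _] _; apply: Rlt_le; apply: Rinv_0_lt_compat; exact: INR_pos.
Qed.

Lemma sum_over_divisors_le (Y : nat) (F : nat -> nat -> R) :
  (forall e k, (0 < e)%N -> (0 < k)%N -> 0 <= F e k) ->
  \rsum_(n <- index_iota 1 Y.+1) \rsum_(e <- index_iota 1 Y.+1 | (e %| n)%N) F e (n %/ e)%N
  <= \rsum_(e <- index_iota 1 Y.+1) \rsum_(k <- index_iota 1 Y.+1) F e k.
Proof.
move=> HF.
have -> : \rsum_(n <- index_iota 1 Y.+1) \rsum_(e <- index_iota 1 Y.+1 | (e %| n)%N) F e (n %/ e)%N
  = \rsum_(n <- index_iota 1 Y.+1) \rsum_(e <- index_iota 1 Y.+1 | (e %| n)%N && (n %/ e <= Y)%N) F e (n %/ e)%N.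
  rewrite big_seq [RHS]big_seq; apply: eq_bigr => n; rewrite mem_index_iota ltnS => /andP [_ Hn].
  by apply: eq_bigl => e; rewrite (leq_trans (leq_div _ _)) ?andbT.
rewrite big_divisor_pairs; apply: rsum_le => e; rewrite mem_index_iota => /andP [He _].
rewrite big_seq_cond [X in _ <= X]big_seq_cond.
apply: rsum_sub_le => [k _ /andP [-> _] //|k /andP []].
by rewrite mem_index_iota => /andP [Hk _] _; exact: HF.
Qed.

Lemma rsum_prod [I J : Type] (r : seq I) (q : seq J) (f : I -> R) (g : J -> R) :
  \rsum_(i <- r) \rsum_(j <- q) (f i * g j) = (\rsum_(i <- r) f i) * (\rsum_(j <- q) g j).
Proof. by rewrite big_distrl /=; apply: eq_bigr => i _; rewrite big_distrr. Qed.

Lemma rsum_iota_le (Y : nat) (F G : nat -> R) :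
  (forall n, (0 < n <= Y)%N -> F n <= G n) ->
  \rsum_(n <- index_iota 1 Y.+1) F n <= \rsum_(n <- index_iota 1 Y.+1) G n.
Proof. by move=> H; apply: rsum_le => n; rewrite mem_index_iota ltnS; exact: H. Qed.

Lemma divisor_count_sum (Y : nat) :
  \rsum_(n <- index_iota 1 Y.+1) (INR (size (divisors n)) / INR n) <= harmonic Y ^ 2.
Proof.
apply (Rle_trans _ (\rsum_(n <- index_iota 1 Y.+1) \rsum_(e <- index_iota 1 Y.+1 | (e %| n)%N)
    (/ INR e * / INR (n %/ e)))).
  apply: rsum_iota_le => n Hn; rewrite -(divisor_count _ _ Hn) /Rdiv big_distrl /=.
  right; rewrite big_seq_cond [RHS]big_seq_cond; apply: eq_bigr => e /andP [].
  rewrite mem_index_iota => /andP [He _] Hen.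
  have Hne : (0 < n %/ e)%N by rewrite divn_gt0 // dvdn_leq //; case/andP: Hn.
  rewrite -{1}(divnK Hen) mult_INR.
  have := INR_pos _ He; have := INR_pos _ Hne => ? ?; field; lra.
apply: Rle_trans (sum_over_divisors_le _ (fun e k => / INR e * / INR k) _) _.
  by move=> e k /INR_pos He /INR_pos Hk; apply: Rmult_le_pos; apply: Rlt_le; apply: Rinv_0_lt_compat.
rewrite rsum_prod -/(harmonic Y); lra.
Qed.

(** With d(n) the number of divisors, d(n)^2 is the sum of d(n) over e | n, and d(n) <= d(e) d(n/e).
    The sum is thus at most the square of the sum of d(n)/n, hence at most the fourth power of the
    harmonic sum. *)
Lemma divisor_count_sq_sum (Y : nat) :
  \rsum_(n <- index_iota 1 Y.+1) (INR (size (divisors n)) ^ 2 / INR n) <= harmonic Y ^ 4.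
Proof.
pose tau n := INR (size (divisors n)).
have Htau : forall n, 0 <= tau n by move=> n; exact: pos_INR.
apply (Rle_trans _ (\rsum_(n <- index_iota 1 Y.+1) \rsum_(e <- index_iota 1 Y.+1 | (e %| n)%N)
    (tau e / INR e * (tau (n %/ e)%N / INR (n %/ e))))).
  apply: rsum_iota_le => n Hn.
  have -> : INR (size (divisors n)) ^ 2 / INR n
      = \rsum_(e <- index_iota 1 Y.+1 | (e %| n)%N) (1 * (tau n / INR n)).
    by rewrite -(big_distrl (times := Rmult)) /= (divisor_count _ _ Hn) /tau /=; lra.
  rewrite big_mkcond [X in _ <= X]big_mkcond; apply: rsum_le => e.
  rewrite mem_index_iota => /andP [He _]; case: ifP => Hen; last exact: Rle_refl.
  have Hne : (0 < n %/ e)%N by rewrite divn_gt0 // dvdn_leq //; case/andP: Hn.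
  have Hn_eq : n = (e * (n %/ e))%N by rewrite mulnC divnK.
  set k := (n %/ e)%N in Hne Hn_eq *; rewrite Hn_eq mult_INR.
  have Pe := INR_pos _ He; have Pk := INR_pos _ Hne.
  have Hmul : tau (e * k)%N <= tau e * tau k.
    by rewrite /tau -mult_INR; apply: le_INR; apply/leP; exact: divisors_mul_size.
  have -> : tau e / INR e * (tau k / INR k) = tau e * tau k / (INR e * INR k) by field; lra.
  rewrite Rmult_1_l /Rdiv; apply: Rmult_le_compat_r => //.
  by apply: Rlt_le; apply: Rinv_0_lt_compat; nra.
apply: Rle_trans (sum_over_divisors_le _ (fun e k => tau e / INR e * (tau k / INR k)) _) _.
  move=> e k /INR_pos He /INR_pos Hk; apply: Rmult_le_pos; apply: Rmult_le_pos => //; apply: Rlt_le; exact: Rinv_0_lt_compat.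
rewrite rsum_prod.
have H := divisor_count_sum Y; rewrite -/(tau _) in H.
have H0 : 0 <= \rsum_(n <- index_iota 1 Y.+1) (tau n / INR n).
  rewrite big_seq_cond; apply: rsum_ge0 => n /andP [].
  rewrite mem_index_iota => /andP [/INR_pos Hn _] _; apply: Rmult_le_pos => //; apply: Rlt_le; exact: Rinv_0_lt_compat.
have -> : harmonic Y ^ 4 = harmonic Y ^ 2 * harmonic Y ^ 2 by ring.
exact: Rmult_le_compat.
Qed.

(** The product has its terms at n <= N^2, and by [mollified_coef_small] only n = 1 survives up to
    N. *)
Lemma mollifier_identity (N : nat) (s : C) : (0 < N)%N ->
  ((\csum_(e <- index_iota 1 N.+1) (RtoC (mobius e) * nat_Cpower e (- s)))
    * (\csum_(k <- index_iota 1 N.+1) nat_Cpower k (- s))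
  = 1 + \csum_(n <- index_iota N.+1 (N * N).+1) (RtoC (mollified_coef N n) * nat_Cpower n (- s)))%C.
Proof.
move=> HN.
have E : (\csum_(n <- index_iota 1 (N * N).+1) (RtoC (mollified_coef N n) * nat_Cpower n (- s)))%C
  = \csum_(e <- index_iota 1 N.+1) \csum_(k <- index_iota 1 N.+1 | (e * k <= N * N)%N)
      (RtoC (mobius e) * nat_Cpower (e * k) (- s))%C.
  rewrite -(big_divisor_pairs _ _ _ N (N * N) (fun e k => RtoC (mobius e) * nat_Cpower (e * k) (- s))%C).
  apply: eq_bigr => n _; rewrite /mollified_coef RtoC_rsum big_distrl /=.
  by apply: eq_bigr => e /andP [Hen _]; rewrite mulnC divnK.
rewrite big_distrl /=.
have -> : \csum_(e <- index_iota 1 N.+1) (RtoC (mobius e) * nat_Cpower e (- s) *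
    \csum_(k <- index_iota 1 N.+1) nat_Cpower k (- s))%C
  = \csum_(e <- index_iota 1 N.+1) \csum_(k <- index_iota 1 N.+1 | (e * k <= N * N)%N)
      (RtoC (mobius e) * nat_Cpower (e * k) (- s))%C.
  rewrite big_seq [RHS]big_seq; apply: eq_bigr => e; rewrite mem_index_iota ltnS => /andP [He HeN].
  rewrite big_distrr /= big_seq [RHS]big_seq_cond; apply: congr_big => // k.
    by rewrite mem_index_iota ltnS; case Hk: (0 < k <= N)%N => //=; rewrite leq_mul //; case/andP: Hk.
  rewrite mem_index_iota => /andP [Hk _].
  by rewrite nat_Cpower_mult ?Cmult_assoc //; apply/ltP.
rewrite -E (@big_cat_nat _ _ _ N.+1) //=; last by rewrite ltnS leq_pmulr.
congr (_ + _)%C.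
rewrite big_ltn // mollified_coef_small // eqxx nat_Cpower_base1.
rewrite big_nat_cond big1; first by rewrite /= Cmult_1_l Cplus_0_r.
move=> n /andP [/andP [Hn HnN] _]; rewrite mollified_coef_small; last by rewrite (leq_trans _ Hn).
by rewrite gtn_eqF // Cmult_0_l.
Qed.

(** * Large values of Dirichlet polynomials *)

Lemma rsum_cauchy_schwarz [I : Type] (r : seq I) (x y : I -> R) :
  (\rsum_(i <- r) (x i * y i)) ^ 2 <= (\rsum_(i <- r) x i ^ 2) * (\rsum_(i <- r) y i ^ 2).
Proof.
elim: r => [|i r IH]; first by rewrite !big_nil; lra.
rewrite !big_cons.
have HA : 0 <= \rsum_(j <- r) x j ^ 2 by apply: rsum_ge0 => j _; exact: pow2_ge_0.
have HB : 0 <= \rsum_(j <- r) y j ^ 2 by apply: rsum_ge0 => j _; exact: pow2_ge_0.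
move: IH HA HB; set S := \rsum_(j <- r) (x j * y j).
set A := \rsum_(j <- r) x j ^ 2; set B := \rsum_(j <- r) y j ^ 2 => IH HA HB.
have Hx := pow2_ge_0 (x i); have Hy := pow2_ge_0 (y i).
(* The cross term: S^2 <= A B followed by the inequality of arithmetic and geometric means, in
   squared form. *)
have Hk : 2 * S * (x i * y i) <= A * y i ^ 2 + B * x i ^ 2.
  have H0 : 0 <= A * y i ^ 2 + B * x i ^ 2.
    by apply: Rplus_le_le_0_compat; apply: Rmult_le_pos.
  apply: Rsqr_incr_0_var => //; rewrite /Rsqr.
  have H1 : S ^ 2 * (x i ^ 2 * y i ^ 2) <= A * B * (x i ^ 2 * y i ^ 2).
    by apply: Rmult_le_compat_r => //; exact: Rmult_le_pos.
  have := pow2_ge_0 (A * y i ^ 2 - B * x i ^ 2); nra.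
change ((x i * y i + S) ^ 2 <= (x i ^ 2 + A) * (y i ^ 2 + B)); nra.
Qed.

Lemma exists_unimodular_phase (z : C) :
  exists c : C, Cmod c <= 1 /\ (c * z)%C = RtoC (Cmod z).
Proof.
have [->|Hz] := classic (z = 0%C).
  by exists 0%C; rewrite Cmod_0 Cmult_0_l; split => //; lra.
have Hm : 0 < Cmod z by apply/Cmod_gt_0.
have Hm' : RtoC (Cmod z) <> 0%C by move=> [H]; lra.
exists (Cconj z / RtoC (Cmod z))%C; split.
  rewrite Cmod_div // Cmod_conj Cmod_R Rabs_right; last lra.
  by right; field; lra.
have -> : (Cconj z / RtoC (Cmod z) * z = (z * Cconj z) / RtoC (Cmod z))%C by field.
rewrite -Cmod2_conj RtoC_pow; field; exact: Hm'.
Qed.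

(** Phases c_j make each modulus equal to c_j times the polynomial, so the sum becomes linear in a_n
    with coefficients b_n. Cauchy-Schwarz with the weights a_n / sqrt n and sqrt n b_n, and
    expansion of |b_n|^2, put n^(1 - s_j - conj s_j') into the kernel; the 1 in the exponent is the
    weight. *)
Lemma dirichlet_polynomial_duality [I : Type] (js : seq I) (r : seq nat) (s : I -> C) (a : nat -> R) :
  all (fun n => 0 < n)%N r ->
  (\rsum_(j <- js) Cmod (\csum_(n <- r) (RtoC (a n) * nat_Cpower n (- s j))%C)) ^ 2
  <= (\rsum_(n <- r) (a n ^ 2 / INR n))
     * \rsum_(j <- js) \rsum_(j' <- js) Cmod (\csum_(n <- r) nat_Cpower n (1 - s j - Cconj (s j'))%C).
Proof.
move=> Hr.
pose D j := \csum_(n <- r) (RtoC (a n) * nat_Cpower n (- s j))%C.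
pose Z j j' := \csum_(n <- r) nat_Cpower n (1 - s j - Cconj (s j'))%C.
pose c j := proj1_sig (constructive_indefinite_description _ (exists_unimodular_phase (D j))).
have Hc : forall j, Cmod (c j) <= 1 /\ (c j * D j)%C = RtoC (Cmod (D j)).
  by move=> j; exact: (proj2_sig (constructive_indefinite_description _ (exists_unimodular_phase (D j)))).
pose b n := \csum_(j <- js) (c j * nat_Cpower n (- s j))%C.
have H1 : RtoC (\rsum_(j <- js) Cmod (D j)) = \csum_(n <- r) (RtoC (a n) * b n)%C.
  rewrite RtoC_rsum /b; under [RHS]eq_bigr => n _ do rewrite big_distrr /=.
  rewrite exchange_big /=; apply: eq_bigr => j _.
  rewrite -(proj2 (Hc j)) /D big_distrr /=; apply: eq_bigr => n _; ring.
have H2 : 0 <= \rsum_(j <- js) Cmod (D j) by apply: rsum_ge0 => j _; exact: Cmod_ge_0.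
have H3 : \rsum_(j <- js) Cmod (D j) <= \rsum_(n <- r) (Rabs (a n) / sqrt (INR n) * (sqrt (INR n) * Cmod (b n))).
  rewrite -(Rabs_right (\rsum_(j <- js) Cmod (D j))); last exact: Rle_ge.
  rewrite -Cmod_R H1; apply: Rle_trans (Cmod_csum _ _ _) _.
  apply: rsum_le => n Hn; right; rewrite Cmod_mult Cmod_R.
  have Hs : 0 < sqrt (INR n) by apply: sqrt_lt_R0; apply: INR_pos; exact: (allP Hr).
  by field; lra.
apply: (Rle_trans _ ((\rsum_(n <- r) (Rabs (a n) / sqrt (INR n) * (sqrt (INR n) * Cmod (b n)))) ^ 2)).
  by apply: pow_incr.
apply: Rle_trans (rsum_cauchy_schwarz _ _ _) _.
have -> : \rsum_(n <- r) (Rabs (a n) / sqrt (INR n)) ^ 2 = \rsum_(n <- r) (a n ^ 2 / INR n).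
  rewrite big_seq [RHS]big_seq; apply: eq_bigr => n Hn.
  have Hp : 0 < INR n by apply: INR_pos; exact: (allP Hr).
  rewrite -(pow2_abs (a n)) -[in RHS](pow2_sqrt (INR n)); last lra.
  have := sqrt_lt_R0 _ Hp => ?; field; lra.
apply: Rmult_le_compat_l.
  rewrite big_seq_cond; apply: rsum_ge0 => n /andP [Hn _]; apply: Rmult_le_pos; first exact: pow2_ge_0.
  by apply: Rlt_le; apply: Rinv_0_lt_compat; apply: INR_pos; exact: (allP Hr).
have H4 : RtoC (\rsum_(n <- r) (sqrt (INR n) * Cmod (b n)) ^ 2)
    = \csum_(j <- js) \csum_(j' <- js) (c j * Cconj (c j') * Z j j')%C.
  rewrite RtoC_rsum.
  transitivity (\csum_(n <- r) \csum_(j <- js) \csum_(j' <- js)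
      (c j * Cconj (c j') * nat_Cpower n (1 - s j - Cconj (s j')))%C).
    rewrite big_seq [RHS]big_seq; apply: eq_bigr => n Hn.
    have Hn0 : (0 < n)%N by exact: (allP Hr).
    rewrite Rpow_mult_distr pow2_sqrt; last exact: pos_INR.
    rewrite RtoC_mult Cmod2_conj /b Cconj_csum -(nat_Cpower_1 n); last by apply/ltP.
    rewrite big_distrl big_distrr /=; apply: eq_bigr => j _.
    rewrite big_distrr big_distrr /=; apply: eq_bigr => j' _.
    have -> : (1 - s j - Cconj (s j') = 1 + - s j + - Cconj (s j'))%C by ring.
    rewrite !nat_Cpower_plus Cmult_conj nat_Cpower_conj Copp_conj; ring.
  rewrite exchange_big /=; apply: eq_bigr => j _.
  rewrite exchange_big /=; apply: eq_bigr => j' _.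
  by rewrite /Z big_distrr.
have H5 : 0 <= \rsum_(n <- r) (sqrt (INR n) * Cmod (b n)) ^ 2 by apply: rsum_ge0 => n _; exact: pow2_ge_0.
rewrite -(Rabs_right (\rsum_(n <- r) (sqrt (INR n) * Cmod (b n)) ^ 2)); last exact: Rle_ge.
rewrite -Cmod_R H4; apply: Rle_trans (Cmod_csum _ _ _) _.
have Hmono : forall (F G : I -> R), (forall j, F j <= G j) -> \rsum_(j <- js) F j <= \rsum_(j <- js) G j.
  move=> F G HFG; apply: (big_ind2 Rle) => //; first exact: Rle_refl.
  by move=> *; apply: Rplus_le_compat.
apply: (Hmono) => j; apply: Rle_trans (Cmod_csum _ _ _) _; apply: (Hmono) => j'.
rewrite !Cmod_mult Cmod_conj -/(Z j j').
have := proj1 (Hc j); have := proj1 (Hc j'); have := Cmod_ge_0 (c j); have := Cmod_ge_0 (c j').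
have := Cmod_ge_0 (Z j j') => HZ h1 h2 h3 h4.
have : Cmod (c j) * Cmod (c j') <= 1 by nra.
nra.
Qed.

Lemma rsum_const [I : Type] (r : seq I) (x : R) : \rsum_(i <- r) x = INR (size r) * x.
Proof.
rewrite -rsum_const1 big_distrl /=; by apply: eq_bigr => i _; rewrite Rmult_1_l.
Qed.

(** With K points, duality gives K^2 / 4 <= A K (diag + K off). The condition A off <= 1/8 lets half
    of the left side absorb the off-diagonal part. *)
Lemma large_values_count [I : eqType] (js : seq I) (r : seq nat) (s : I -> C) (a : nat -> R)
    (A diag off : R) :
  uniq js -> all (fun n => 0 < n)%N r -> 0 <= diag -> 0 <= off ->
  \rsum_(n <- r) (a n ^ 2 / INR n) <= A -> A * off <= 1 / 8 ->
  (forall j, j \in js -> 1 / 2 <= Cmod (\csum_(n <- r) (RtoC (a n) * nat_Cpower n (- s j))%C)) ->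
  (forall j, j \in js -> Cmod (\csum_(n <- r) nat_Cpower n (1 - s j - Cconj (s j))%C) <= diag) ->
  (forall j j', j \in js -> j' \in js -> j != j' ->
     Cmod (\csum_(n <- r) nat_Cpower n (1 - s j - Cconj (s j'))%C) <= off) ->
  INR (size js) <= 8 * A * diag.
Proof.
move=> Hu Hr Hd Ho HA HAo Hlarge Hdiag Hoff.
have Hdual := dirichlet_polynomial_duality js r s a Hr.
set K := INR (size js).
have HK : 0 <= K by exact: pos_INR.
have HA0 : 0 <= \rsum_(n <- r) (a n ^ 2 / INR n).
  rewrite big_seq_cond; apply: rsum_ge0 => n /andP [Hn _]; apply: Rmult_le_pos; first exact: pow2_ge_0.
  by apply: Rlt_le; apply: Rinv_0_lt_compat; apply: INR_pos; exact: (allP Hr).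
have H1 : K * (1 / 2) <= \rsum_(j <- js) Cmod (\csum_(n <- r) (RtoC (a n) * nat_Cpower n (- s j))%C).
  by rewrite -rsum_const; apply: rsum_le => j Hj; exact: Hlarge.
have H2 : \rsum_(j <- js) \rsum_(j' <- js) Cmod (\csum_(n <- r) nat_Cpower n (1 - s j - Cconj (s j'))%C)
    <= K * (diag + K * off).
  rewrite -rsum_const; apply: rsum_le => j Hj.
  rewrite (bigD1_seq j) //=; apply: Rplus_le_compat; first exact: Hdiag.
  rewrite -rsum_const; apply: Rle_trans (rsum_sub_le _ _ xpredT (fun _ => off) _ _) => //.
  rewrite big_seq_cond [X in _ <= X]big_seq_cond.
  apply: (big_ind2 Rle); [exact: Rle_refl | by move=> *; apply: Rplus_le_compat |].
  by move=> j' /andP [Hj' Hne]; apply: Hoff => //; rewrite eq_sym.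
have H3 : (K * (1 / 2)) ^ 2 <= A * (K * (diag + K * off)).
  apply: Rle_trans (_ : _ <= (\rsum_(j <- js) Cmod (\csum_(n <- r) (RtoC (a n) * nat_Cpower n (- s j))%C)) ^ 2) _.
    by apply: pow_incr; split => //; lra.
  apply: Rle_trans Hdual _; apply: Rmult_le_compat => //.
  apply: rsum_ge0 => j _; apply: rsum_ge0 => j' _; exact: Cmod_ge_0.
have [HK0|HK0] := Rle_lt_dec K 0.
  by apply: Rle_trans HK0 _; apply: Rmult_le_pos => //; lra.
have H4 : A * off * (K * K) <= 1 / 8 * (K * K) by apply: Rmult_le_compat_r => //; nra.
apply (Rmult_le_reg_r K) => //; lra.
Qed.

(** The kernel sum is expressed without zeta: the difference of the approximations is controlled by
    [zeta_approx_dist], and the pole terms are small when w is far from 1. *)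
Lemma csum_zeta_approx (N Y : nat) (w : C) : (0 < N <= Y)%N -> w <> 1%C ->
  \csum_(n <- index_iota N.+1 Y.+1) nat_Cpower n (- w)
  = (zeta_approx Y w - zeta_approx N w
     - (nat_Cpower Y (1 - w) - nat_Cpower N (1 - w)) / (w - 1))%C.
Proof.
move=> /andP [HN HNY] Hw.
have Hz : (w - 1 <> 0)%C by move=> H; apply: Hw; rewrite -(Cplus_0_r 1%C) -H; ring.
rewrite /zeta_approx (@big_cat_nat _ _ _ N.+1 1 Y.+1) //=.
set S := \big[_/_]_(_ <= _ < _) _; set S' := \big[_/_]_(_ <= _ < _) _.
set P := nat_Cpower Y _; set Q := nat_Cpower N _; field; exact: Hz.
Qed.

Lemma Cmod_nat_Cpower_le (n Y : nat) (z : C) (x : R) : (0 < n <= Y)%N -> 0 <= x -> Re z <= x ->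
  Cmod (nat_Cpower n z) <= Rpower (INR Y) x.
Proof.
move=> /andP [Hn HnY] Hx Hz; rewrite Cmod_nat_Cpower.
have H1 : 1 <= INR n by apply: (le_INR 1); apply/leP.
have H2 : INR n <= INR Y by apply: le_INR; apply/leP.
apply (Rle_trans _ (Rpower (INR n) x)); first exact: Rle_Rpower.
apply: Rle_Rpower_l => //; lra.
Qed.

(** From n^z = n^(z+1) / n, with the first factor at most Y^x. Allowing any [F] dominated by n^z
    covers the Mobius coefficients. *)
Lemma Cmod_csum_harmonic (N Y : nat) (F : nat -> C) (z : C) (x : R) : 0 <= x -> Re z <= x - 1 ->
  (forall n, (0 < n)%N -> Cmod (F n) <= Cmod (nat_Cpower n z)) ->
  Cmod (\csum_(n <- index_iota N.+1 Y.+1) F n) <= Rpower (INR Y) x * harmonic Y.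
Proof.
move=> Hx Hz HF; apply: Rle_trans (Cmod_csum _ _ _) _.
have Hp : 0 < Rpower (INR Y) x by exact: exp_pos.
rewrite /harmonic big_distrr /=.
apply (Rle_trans _ (\rsum_(n <- index_iota N.+1 Y.+1) (Rpower (INR Y) x * / INR n))).
  apply: rsum_le => n; rewrite mem_index_iota ltnS => /andP [Hn HnY].
  have Hn0 : (0 < n)%N by apply: leq_trans Hn.
  apply: Rle_trans (HF n Hn0) _.
  have -> : z = ((z + 1) + - 1)%C by ring.
  rewrite nat_Cpower_plus Cmod_mult; apply: Rmult_le_compat; try exact: Cmod_ge_0.
    by apply: Cmod_nat_Cpower_le => //; [rewrite Hn0 | move: Hz; rewrite /Re /=; lra].
  rewrite Cmod_nat_Cpower /Re /= Rpower_Ropp Rpower_1; [exact: Rle_refl | exact: INR_pos].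
have Hpos : forall n, (1 <= n)%N -> 0 <= Rpower (INR Y) x * / INR n.
  by move=> n /INR_pos Hn; apply: Rmult_le_pos; [lra | apply: Rlt_le; exact: Rinv_0_lt_compat].
have [HNY|HNY] := leqP N Y; first by apply: rsum_interval_le.
rewrite big_geq ?ltnS ?(ltnW HNY) // big_seq_cond; apply: rsum_ge0 => n /andP [].
by rewrite mem_index_iota => /andP [Hn _] _; exact: Hpos.
Qed.

(** * Counting zeros *)

Lemma Rpower_pow_root (W : R) (n : nat) (x y : R) : 0 < W -> INR n * x = y -> Rpower (W ^ n) x = Rpower W y.
Proof. by move=> HW <-; rewrite -Rpower_pow // Rpower_mult. Qed.

Section ZeroDetection.

(** In the application [W] is 4^nu and [L] is 1 + 64 nu, which plays the role of log T. *)
Variables (W : R) (N : nat) (L : R).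
Hypotheses (HW : 1 <= W) (HN : INR N = W ^ 16) (HL : harmonic (N * N) <= L).

Lemma detection_length_pos : (0 < N)%N.
Proof.
apply/ltP; apply: INR_lt; rewrite HN; apply: pow_lt; lra.
Qed.

Lemma sqrt_detection_length : sqrt (INR N) = W ^ 8.
Proof.
rewrite HN (_ : W ^ 16 = W ^ 8 * W ^ 8); last by ring.
by rewrite sqrt_square //; apply: pow_le; lra.
Qed.

Lemma Rpower_detection_length : Rpower (INR (N * N)) (1 / 32) = W.
Proof.
rewrite mult_INR HN (_ : W ^ 16 * W ^ 16 = W ^ 32); last by ring.
rewrite (Rpower_pow_root W 32 (1 / 32) 1); [apply: Rpower_1; lra | lra |].
by rewrite INR_IZR_INZ /=; field.
Qed.

Lemma harmonic_N_le : harmonic N <= L.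
Proof.
apply: Rle_trans HL; have HN0 := detection_length_pos.
apply: rsum_interval_le => //; first by rewrite ltnS leq_pmulr.
by move=> n /INR_pos Hn; apply: Rlt_le; exact: Rinv_0_lt_compat.
Qed.

Lemma Rpower_N_le (x : R) : 0 <= x <= 1 / 32 -> Rpower (INR N) x <= W.
Proof.
move=> Hx; have HN0 := INR_pos _ detection_length_pos.
have HN1 : 1 <= INR N by rewrite HN; apply: pow_R1_Rle.
apply (Rle_trans _ (Rpower (INR N) (1 / 32))); first by apply: Rle_Rpower; lra.
rewrite -Rpower_detection_length; apply: Rle_Rpower_l; first lra.
rewrite mult_INR; nra.
Qed.

(** The mollifier is at most W L and the partial sum at most 161 / W^3, so their product is at most
    161 L / W^2 <= 1/2, while it equals 1 plus the long sum. The 322 is 2 times 161. *)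
Lemma zero_detection (zeta : C -> C) (s : C) :
  is_riemann_zeta zeta -> zeta s = 0%C -> 63 / 64 <= Re s <= 2 -> 2 <= W ->
  W ^ 4 <= Im s <= 2 * W ^ 4 -> 322 * L <= W ^ 2 ->
  1 / 2 <= Cmod (\csum_(n <- index_iota N.+1 (N * N).+1) (RtoC (mollified_coef N n) * nat_Cpower n (- s))%C).
Proof.
move=> Hzeta Hs Hre HW2 Him HLW.
have HN0 := detection_length_pos.
have HW4 : 16 <= W ^ 4 by have H := pow_incr 2 W 4 ltac:(lra); lra.
have Hid := mollifier_identity N s HN0.
set M := \csum_(e <- _) _ in Hid; set Z := \csum_(k <- _) _ in Hid; set D := \csum_(n <- _) _ in Hid *.
have Hs1 : s <> 1%C by move=> H; rewrite H /Im /= in Him; lra.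
have Hz : (s - 1 <> 0)%C by move=> H; apply: Hs1; rewrite -(Cplus_0_r 1%C) -H; ring.
have Hlow : W ^ 4 <= Cmod (s - 1).
  apply: Rle_trans (im_le_Cmod _); apply: Rle_trans (Rle_abs _).
  by move: Him; rewrite /Im /=; lra.
have Hup : Cmod (s - 1) <= 1 + 2 * W ^ 4.
  apply: Rle_trans (Cmod_le_sum _) _.
  have -> : Re (s - 1)%C = Re s - 1 by rewrite /Re /=; ring.
  have -> : Im (s - 1)%C = Im s by rewrite /Im /=; ring.
  apply: Rplus_le_compat; [apply/Rabs_le_between; lra | rewrite Rabs_right; lra].
have HM : Cmod M <= W * L.
  apply (Rle_trans _ (Rpower (INR N) (1 / 64) * harmonic N)); last first.
    apply: Rmult_le_compat; [exact: Rlt_le (exp_pos _) | exact: harmonic_ge0 | apply: Rpower_N_le; lra | exact: harmonic_N_le].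
  apply: (Cmod_csum_harmonic 0 N _ (- s)%C); [lra | move: Hre; rewrite /Re /=; lra |].
  move=> n Hn; rewrite Cmod_mult Cmod_R.
  have := mobius_bound n Hn; have := Cmod_ge_0 (nat_Cpower n (- s)); have := Rabs_pos (mobius n); nra.
have HWi : 0 < / W by apply: Rinv_0_lt_compat; lra.
have HWi1 : / W <= 1 by rewrite -Rinv_1; apply: Rinv_le_contravar; lra.
(* At a zero the partial sum is the approximation error, up to 160 / W^4, plus the pole term, up to
   W / W^4. *)
have HZ : Cmod Z <= 161 * (/ W) ^ 3.
  have E := zeta_approx_error zeta N s Hzeta HN0 ltac:(lra) ltac:(lra).
  rewrite sqrt_detection_length Hs in E.
  have -> : Z = (- (0 - zeta_approx N s) + - (nat_Cpower N (1 - s) / (s - 1)))%C.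
    by rewrite /zeta_approx -/Z; ring.
  apply: Rle_trans (Cmod_triangle _ _) _; rewrite !Cmod_opp.
  have E1 : Cmod (0 - zeta_approx N s) <= 160 * (/ W) ^ 3.
    apply: Rle_trans E _.
    apply (Rle_trans _ (40 * (4 * W ^ 4) / W ^ 8)).
      rewrite /Rdiv; apply: Rmult_le_compat_r; first by apply: Rlt_le; apply: Rinv_0_lt_compat; apply: pow_lt; lra.
      lra.
    have -> : 40 * (4 * W ^ 4) / W ^ 8 = 160 * (/ W) ^ 3 * / W by field; lra.
    have := pow_lt _ 3 HWi; nra.
  have E2 : Cmod (nat_Cpower N (1 - s) / (s - 1)) <= (/ W) ^ 3.
    rewrite Cmod_div //.
    apply (Rle_trans _ (W * / W ^ 4)); last by right; field; lra.
    apply: Rmult_le_compat; [exact: Cmod_ge_0 | by apply: Rlt_le; apply: Rinv_0_lt_compat; lra | | by apply: Rinv_le_contravar; lra].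
    apply: Rle_trans (Rpower_N_le (1 / 64) _); last lra.
    by apply: Cmod_nat_Cpower_le; [rewrite HN0 leqnn | lra | move: Hre; rewrite /Re /=; lra].
  lra.
have HMZ : Cmod (M * Z) <= 1 / 2.
  rewrite Cmod_mult; apply (Rle_trans _ (W * L * (161 * (/ W) ^ 3))).
    apply: Rmult_le_compat => //; exact: Cmod_ge_0.
  have -> : W * L * (161 * (/ W) ^ 3) = 161 * L / W ^ 2 by field; lra.
  have HW2' : 0 < W ^ 2 by apply: pow_lt; lra.
  apply (Rmult_le_reg_r (W ^ 2)) => //.
  have -> : 161 * L / W ^ 2 * W ^ 2 = 161 * L by field; lra.
  lra.
have := Cmod_triangle (M * Z) (- D).
have -> : (M * Z + - D = 1)%C by rewrite Hid; ring.
rewrite Cmod_1 Cmod_opp; lra.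
Qed.

Lemma kernel_diagonal (s : C) : 63 / 64 <= Re s ->
  Cmod (\csum_(n <- index_iota N.+1 (N * N).+1) nat_Cpower n (1 - s - Cconj s)%C) <= W * L.
Proof.
move=> Hs; rewrite -Rpower_detection_length.
apply (Rle_trans _ (Rpower (INR (N * N)) (1 / 32) * harmonic (N * N))).
  apply: (Cmod_csum_harmonic _ _ _ (1 - s - Cconj s)%C); [lra | | by move=> n _; exact: Rle_refl].
  by move: Hs; rewrite /Re /=; lra.
apply: Rmult_le_compat_l => //; exact: Rlt_le (exp_pos _).
Qed.

(** The spacing enters through |w - 1| >= W^2 / 2 in the pole terms, which contribute 2 W / (W^2 /
    2) = 4 / W; the approximations differ by at most 160 / W. *)
Lemma kernel_off_diagonal (s s' : C) :
  63 / 64 <= Re s <= 2 -> 63 / 64 <= Re s' <= 2 ->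
  W ^ 2 / 2 <= Rabs (Im s - Im s') <= W ^ 4 ->
  Cmod (\csum_(n <- index_iota N.+1 (N * N).+1) nat_Cpower n (1 - s - Cconj s')%C) <= 164 / W.
Proof.
move=> Hs Hs' Him.
have HN0 := detection_length_pos.
pose w := (s + Cconj s' - 1)%C.
have Hrw : Re w = Re s + Re s' - 1 by rewrite /w /Re /=; ring.
have Hiw : Im w = Im s - Im s' by rewrite /w /Im /=; ring.
have HW2 : 1 <= W ^ 2 by apply: pow_R1_Rle.
have HW4 : 1 <= W ^ 4 by apply: pow_R1_Rle.
have Hw1 : w <> 1%C.
  by move=> H; move: Him; rewrite -Hiw H /Im /= Rabs_R0; lra.
have Hz : (w - 1 <> 0)%C by move=> H; apply: Hw1; rewrite -(Cplus_0_r 1%C) -H; ring.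
have -> : (1 - s - Cconj s' = - w)%C by rewrite /w; ring.
have HNY : (0 < N <= N * N)%N by rewrite HN0 leq_pmulr.
rewrite csum_zeta_approx //.
have E := zeta_approx_dist N (N * N) w HNY ltac:(lra) Hw1.
rewrite sqrt_detection_length in E.
have Him1 : Im (w - 1)%C = Im s - Im s' by rewrite -Hiw /Im /=; ring.
have Hlow : W ^ 2 / 2 <= Cmod (w - 1).
  by apply: Rle_trans (im_le_Cmod _); rewrite Him1; lra.
have Hup : Cmod (w - 1) <= 2 + W ^ 4.
  apply: Rle_trans (Cmod_le_sum _) _; rewrite Him1.
  have -> : Re (w - 1)%C = Re s + Re s' - 2 by rewrite -[X in X - _](_ : Re w + 1 = _); [rewrite /Re /=; ring | rewrite Hrw; ring].
  apply: Rplus_le_compat; [apply/Rabs_le_between; lra | lra].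
apply: Rle_trans (Cmod_triangle _ _) _; rewrite Cmod_opp.
have HWi : 0 < / W by apply: Rinv_0_lt_compat; lra.
have E1 : Cmod (zeta_approx (N * N) w - zeta_approx N w) <= 160 / W.
  apply: Rle_trans E _.
  apply (Rle_trans _ (40 * (4 * W ^ 4) / W ^ 8)).
    rewrite /Rdiv; apply: Rmult_le_compat_r; first by apply: Rlt_le; apply: Rinv_0_lt_compat; apply: pow_lt; lra.
    lra.
  have -> : 40 * (4 * W ^ 4) / W ^ 8 = 160 * ((/ W) ^ 3 * / W) by field; lra.
  rewrite /Rdiv; apply: Rmult_le_compat_l; first lra.
  have : (/ W) ^ 3 <= 1 by rewrite -(pow1 3); apply: pow_incr; split; [lra | rewrite -Rinv_1; apply: Rinv_le_contravar; lra].
  nra.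
have Hpow : forall n, (0 < n <= N * N)%N -> Cmod (nat_Cpower n (1 - w)) <= W.
  move=> n Hn; rewrite -Rpower_detection_length; apply: Cmod_nat_Cpower_le => //; first lra.
  have -> : Re (1 - w)%C = 1 - Re w by rewrite /Re /=; ring.
  lra.
have E2 : Cmod ((nat_Cpower (N * N) (1 - w) - nat_Cpower N (1 - w)) / (w - 1)) <= 4 / W.
  rewrite Cmod_div //.
  apply (Rle_trans _ ((2 * W) * / (W ^ 2 / 2))); last by right; field; lra.
  apply: Rmult_le_compat; [exact: Cmod_ge_0 | by apply: Rlt_le; apply: Rinv_0_lt_compat; lra | | by apply: Rinv_le_contravar; lra].
  apply: Rle_trans (Cmod_triangle _ _) _; rewrite Cmod_opp.
  have := Hpow (N * N)%N ltac:(by rewrite muln_gt0 HN0 leqnn); have := Hpow N HNY; lra.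
lra.
Qed.

Lemma mollified_coef_energy :
  \rsum_(n <- index_iota N.+1 (N * N).+1) (mollified_coef N n ^ 2 / INR n) <= L ^ 4.
Proof.
have HN0 := detection_length_pos.
apply (Rle_trans _ (\rsum_(n <- index_iota 1 (N * N).+1) (INR (size (divisors n)) ^ 2 / INR n))); last first.
  apply: Rle_trans (divisor_count_sq_sum _) _; apply: pow_incr; split => //; exact: harmonic_ge0.
apply (Rle_trans _ (\rsum_(n <- index_iota N.+1 (N * N).+1) (INR (size (divisors n)) ^ 2 / INR n))); last first.
  apply: rsum_interval_le => //; first by rewrite /= ltnS leq_pmulr.
  by move=> n /INR_pos Hn; apply: Rmult_le_pos; [exact: pow2_ge_0 | apply: Rlt_le; exact: Rinv_0_lt_compat].
apply: rsum_le => n; rewrite mem_index_iota => /andP [Hn _].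
have Hn0 : (0 < n)%N by apply: leq_trans Hn.
rewrite /Rdiv; apply: Rmult_le_compat_r; first by apply: Rlt_le; apply: Rinv_0_lt_compat; exact: INR_pos.
rewrite -(pow2_abs (mollified_coef N n)); apply: pow_incr; split; [exact: Rabs_pos | exact: mollified_coef_bound].
Qed.

(** The constant 1312 is 8 times 164: it makes the energy L^4 times the off-diagonal bound 164 / W
    at most 1/8, and also implies the condition of [zero_detection]. *)
Lemma separated_zeros_count (zeta : C -> C) (js : seq nat) (s : nat -> C) :
  is_riemann_zeta zeta -> 2 <= W -> 1 <= L -> 1312 * L ^ 4 <= W -> uniq js ->
  (forall j, j \in js -> zeta (s j) = 0%C /\ 63 / 64 <= Re (s j) <= 2 /\ W ^ 4 <= Im (s j) <= 2 * W ^ 4) ->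
  (forall j j', j \in js -> j' \in js -> j != j' -> W ^ 2 / 2 <= Rabs (Im (s j) - Im (s j'))) ->
  INR (size js) <= 8 * L ^ 5 * W.
Proof.
move=> Hzeta HW2 HL1 HLW Hu Hs Hsep.
have HL4 : L <= L ^ 4 by have := pow_R1_Rle L 3 HL1; rewrite (_ : L ^ 4 = L * L ^ 3); [nra | ring].
have -> : 8 * L ^ 5 * W = 8 * L ^ 4 * (W * L) by ring.
apply: (large_values_count js (index_iota N.+1 (N * N).+1) s (mollified_coef N) _ _ (164 / W)) => //.
- apply/allP => n; rewrite mem_index_iota => /andP [Hn _]; exact: leq_trans Hn.
- nra.
- by apply: Rlt_le; apply: Rdiv_lt_0_compat; lra.
- exact: mollified_coef_energy.
- apply (Rmult_le_reg_r W); first lra.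
  have -> : L ^ 4 * (164 / W) * W = 164 * L ^ 4 by field; lra.
  lra.
- move=> j /Hs [H1 [H2 H3]]; apply: (zero_detection zeta) => //; nra.
- by move=> j /Hs [_ [H2 _]]; apply: kernel_diagonal; lra.
- move=> j j' Hj Hj' Hne; have [_ [H2 H3]] := Hs j Hj; have [_ [H2' H3']] := Hs j' Hj'.
  apply: kernel_off_diagonal => //; split; first exact: Hsep.
  by apply/Rabs_le_between; lra.
Qed.

End ZeroDetection.

(** * From separated zeros to bad intervals *)

(** From x/6 <= exp(x/6) follows (x/6)^6 <= exp x <= 4^x, and a sixth power beats a fifth; the
    threshold collects the constants 65^5 and 6^6. *)
Lemma polynomial_le_pow4 (K : R) : 0 < K ->
  exists nu0 : R, forall nu : nat, (0 < nu)%N -> nu0 <= INR nu -> K * (1 + 64 * INR nu) ^ 5 <= 4 ^ nu.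
Proof.
move=> HK; exists (K * 65 ^ 5 * 6 ^ 6) => nu Hnu Hnu0.
have Hx : 1 <= INR nu by apply: (le_INR 1); apply/leP.
set x := INR nu in Hx Hnu0 *.
have H1 : (1 + 64 * x) ^ 5 <= (65 * x) ^ 5 by apply: pow_incr; lra.
have H2 : (x / 6) ^ 6 <= 4 ^ nu.
  apply (Rle_trans _ (exp (x / 6) ^ 6)).
    apply: pow_incr; split; first lra.
    have := exp_ineq1_le (x / 6); lra.
  rewrite -Rpower_pow; last exact: exp_pos.
  rewrite -Rpower_pow; last lra.
  rewrite /Rpower ln_exp; apply: exp_monotone.
  have -> : INR 6 * (x / 6) = x by rewrite INR_IZR_INZ /=; field.
  rewrite -/x.
  have : 1 <= ln 4.
    rewrite -{1}(ln_exp 1); apply: ln_le; [exact: exp_pos | have := exp_le_3; lra].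
  nra.
apply: Rle_trans H2.
apply (Rle_trans _ (K * (65 * x) ^ 5)); first by apply: Rmult_le_compat_l; lra.
have -> : K * (65 * x) ^ 5 = K * 65 ^ 5 * 6 ^ 6 * (x ^ 5 / 6 ^ 6) by field.
have -> : (x / 6) ^ 6 = x * (x ^ 5 / 6 ^ 6) by field.
apply: Rmult_le_compat_r => //; apply: Rmult_le_pos; [apply: pow_le; lra | lra].
Qed.

Lemma two_Rpower_multiple (k nu : nat) : two_Rpower (INR k * INR nu) = (2 ^ nu) ^ k.
Proof. by rewrite /two_Rpower -mult_INR Rpower_pow ?mult_n_Sm; [rewrite Nat.mul_comm pow_mult | lra]. Qed.

(** N^2 = 2^(64 nu), and log 2 <= 1. *)
Lemma harmonic_power_le (N nu : nat) : (0 < N)%N -> INR N = (4 ^ nu) ^ 16 -> harmonic (N * N) <= 1 + 64 * INR nu.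
Proof.
move=> HN0 HN; apply: Rle_trans (harmonic_bound _ _) _; first by rewrite muln_gt0 HN0.
apply: Rplus_le_compat_l.
have -> : INR (N * N) = 2 ^ (64 * nu)%coq_nat.
  rewrite mult_INR HN (_ : 4 = 2 ^ 2); last by ring.
  rewrite -!pow_mult -Rdef_pow_add; congr (_ ^ _); lia.
rewrite -Rpower_pow; last lra.
rewrite /Rpower ln_exp mult_INR (_ : INR 64 = 64); last by rewrite INR_IZR_INZ.
have Hln : ln 2 <= 1.
  rewrite -[X in _ <= X](ln_exp 1); apply: ln_le; first lra.
  have := exp_ineq1_le 1; lra.
have := pos_INR nu; nra.
Qed.

Lemma subdivision_interval_4 (nu j : nat) (t : R) :
  subdivision_interval 4 nu (Z.of_nat j) t <->
  (4 ^ nu) ^ 4 + (INR j - 1) * ((4 ^ nu) ^ 2 / 2) <= t < (4 ^ nu) ^ 4 + INR j * ((4 ^ nu) ^ 2 / 2).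
Proof.
have H4 : 4 ^ nu = (2 ^ nu) ^ 2 by rewrite -pow_mult Nat.mul_comm pow_mult; congr (_ ^ _); ring.
have E1 : two_Rpower (2 * 4 * INR nu) = (4 ^ nu) ^ 4.
  rewrite (_ : 2 * 4 = INR 8); last by rewrite INR_IZR_INZ /=; ring.
  by rewrite two_Rpower_multiple H4; ring.
have E2 : two_Rpower (4 * INR nu - 1) = (4 ^ nu) ^ 2 / 2.
  rewrite /two_Rpower /Rminus Rpower_plus -/(two_Rpower _) (_ : 4 * INR nu = INR 4 * INR nu); last by rewrite (INR_IZR_INZ 4).
  rewrite two_Rpower_multiple Rpower_Ropp Rpower_1; last lra.
  by rewrite H4 /Rdiv; ring.
by rewrite /subdivision_interval E1 E2 -INR_IZR_INZ.
Qed.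

Lemma index_bound_4 (nu : nat) : two_Rpower (4 * INR nu + 1) = 2 * (4 ^ nu) ^ 2.
Proof.
have H4 : 4 ^ nu = (2 ^ nu) ^ 2 by rewrite -pow_mult Nat.mul_comm pow_mult; congr (_ ^ _); ring.
rewrite /two_Rpower Rpower_plus -/(two_Rpower _) (_ : 4 * INR nu = INR 4 * INR nu); last by rewrite (INR_IZR_INZ 4).
rewrite two_Rpower_multiple Rpower_1; last lra.
by rewrite H4; ring.
Qed.

(** Between two intervals whose distinct indices have the same parity lies at least one whole
    interval, so one zero from each gives a set of zeros with the required spacing. *)
Lemma bad_indices_count (zeta : C -> C) (nu : nat) (js : seq nat) (parity : bool) :
  is_riemann_zeta zeta -> (0 < nu)%N -> 1312 * (1 + 64 * INR nu) ^ 4 <= 4 ^ nu -> uniq js ->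
  (forall j, j \in js -> (0 < j)%N /\ INR j <= 2 * (4 ^ nu) ^ 2 /\ odd j = parity /\
     ~ zero_free_index zeta (63 / 64) 4 nu (Z.of_nat j)) ->
  INR (size js) <= 8 * (1 + 64 * INR nu) ^ 5 * 4 ^ nu.
Proof.
move=> Hzeta Hnu Hlarge Hu Hjs.
set W := 4 ^ nu in Hlarge Hjs *.
have Hx : 1 <= INR nu by apply: (le_INR 1); apply/leP.
have HW : 4 <= W.
  by rewrite /W -{1}(pow_1 4); apply: Rle_pow; [lra | apply/leP].
have [N HN] : exists N, INR N = W ^ 16.
  by exists (Nat.pow (Nat.pow 4 nu) 16); rewrite !pow_INR /W (INR_IZR_INZ 4).
have HN0 : (0 < N)%N by apply/ltP; apply: INR_lt; rewrite HN; apply: pow_lt; lra.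
have HL := harmonic_power_le N nu HN0 HN.
(* Indices outside [js] get the default value 0, which makes the choice of a zero a total
   function. *)
have Hs : forall j, exists s : C, j \in js -> zeta s = 0%C /\ 63 / 64 <= Re s <= 2 /\
    W ^ 4 + (INR j - 1) * (W ^ 2 / 2) <= Im s < W ^ 4 + INR j * (W ^ 2 / 2).
  move=> j; have [Hj|Hj] := classic (j \in js); last by exists 0%C.
  have [_ [_ [_ Hbad]]] := Hjs j Hj.
  apply: NNPP => Hn; apply: Hbad => sigma t Hsig Ht Hz; apply: Hn.
  exists (sigma, t) => _; split=> //; move/subdivision_interval_4: Ht => Ht; split => //.
  rewrite /Re /=; split => //; apply: Rnot_lt_le => Hgt.
  by apply: (zeta_neq0_right zeta (sigma, t) _ _ Hz); [apply Hzeta; rewrite /Re /=; lra | rewrite /Re /=; lra].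
pose s j := proj1_sig (constructive_indefinite_description _ (Hs j)).
have sP : forall j, j \in js -> zeta (s j) = 0%C /\ 63 / 64 <= Re (s j) <= 2 /\
    W ^ 4 + (INR j - 1) * (W ^ 2 / 2) <= Im (s j) < W ^ 4 + INR j * (W ^ 2 / 2).
  by move=> j; exact: (proj2_sig (constructive_indefinite_description _ (Hs j))).
have HW2 : 0 < W ^ 2 by apply: pow_lt; lra.
apply: (separated_zeros_count W N (1 + 64 * INR nu) _ HN HL zeta js s) => //; try lra.
- move=> j Hj; have [H1 [H2 H3]] := sP j Hj; have [H4 [H5 _]] := Hjs j Hj.
  have Hj1 : 1 <= INR j by apply: (le_INR 1); apply/leP.
  split=> //; split=> //; split.
    have : 0 <= (INR j - 1) * (W ^ 2 / 2) by apply: Rmult_le_pos; lra.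
    lra.
  (* The last index, 2 W^2, ends at height 2 W^4. *)
  have : INR j * (W ^ 2 / 2) <= 2 * W ^ 2 * (W ^ 2 / 2) by apply: Rmult_le_compat_r; lra.
  rewrite (_ : 2 * W ^ 2 * (W ^ 2 / 2) = W ^ 4); last field.
  lra.
- have Hwlog : forall j j', j \in js -> j' \in js -> (j < j')%N -> W ^ 2 / 2 <= Im (s j') - Im (s j).
    move=> j j' Hj Hj' Hlt.
    have [_ [_ H3]] := sP j Hj; have [_ [_ H3']] := sP j' Hj'.
    have [_ [_ [Hp _]]] := Hjs j Hj; have [_ [_ [Hp' _]]] := Hjs j' Hj'.
    have Hlt2 : (j.+2 <= j')%N.
      rewrite ltn_neqAle Hlt andbT; apply/eqP => E; move: Hp'; rewrite -E /= Hp; by case: (parity).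
    have : INR j.+2 <= INR j' by apply: le_INR; apply/leP.
    rewrite !S_INR => H5.
    have : (INR j + 1) * (W ^ 2 / 2) <= (INR j' - 1) * (W ^ 2 / 2) by apply: Rmult_le_compat_r; lra.
    lra.
  move=> j j' Hj Hj'; rewrite neq_ltn => /orP [Hlt|Hlt].
    have := Hwlog j j' Hj Hj' Hlt => H; rewrite Rabs_minus_sym Rabs_right; lra.
  have := Hwlog j' j Hj' Hj Hlt => H; rewrite Rabs_right; lra.
Qed.

Lemma In_mem (s : seq nat) (j : nat) : List.In j s <-> j \in s.
Proof.
elim: s => [|x s IH] //=; rewrite inE; split.
- by move=> [->|/IH ->]; rewrite ?eqxx ?orbT.
- by move=> /orP [/eqP ->|/IH H]; [left | right].
Qed.

Lemma NoDup_map_of_nat (s : seq nat) : uniq s -> NoDup (List.map Z.of_nat s).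
Proof.
elim: s => [|x s IH] /=; first by move=> _; exact: NoDup_nil.
move=> /andP [/negP Hx Hs]; apply: NoDup_cons; last exact: IH.
move=> /List.in_map_iff [y [/Nat2Z.inj Hy /In_mem Hin]]; apply: Hx; by rewrite -Hy.
Qed.

Lemma zero_free_indices (zeta : C -> C) (alpha : R) :
  is_riemann_zeta zeta -> 0 < alpha < 1 ->
  exists sigma0 B nu0 : R, 1 / 2 < sigma0 < 1 /\ 4 <= B /\
    forall nu : nat, (1 <= nu)%coq_nat -> nu0 <= INR nu ->
      at_least (alpha * two_Rpower (B * INR nu + 1))
        (fun j : Z => (1 <= j)%Z /\ IZR j <= two_Rpower (B * INR nu + 1) /\
           zero_free_index zeta sigma0 B nu j).
Proof.
move=> Hzeta Halpha.
have HK : 0 < 8 / (1 - alpha) by apply: Rdiv_lt_0_compat; lra.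
(* The summand 1312 provides the hypothesis of [bad_indices_count]; the other makes its bound at
   most (1 - alpha) W^2 for each parity, that is, a proportion 1 - alpha of the 2 W^2 indices in
   all. *)
have [nu0 Hnu0] := polynomial_le_pow4 (1312 + 8 / (1 - alpha)) ltac:(lra).
exists (63 / 64), 4, nu0; split; first lra; split; first lra.
move=> nu /leP Hnu Hnu1; have Hlarge := Hnu0 nu Hnu Hnu1.
rewrite index_bound_4.
set W := 4 ^ nu in Hlarge *; set L := 1 + 64 * INR nu in Hlarge.
have HL : 1 <= L by rewrite /L; have := pos_INR nu; lra.
have HL4 : 0 < L ^ 4 by apply: pow_lt; lra.
have HL5 : L ^ 4 <= L ^ 5 by rewrite (_ : L ^ 5 = L * L ^ 4); [nra | ring].
have HW : 0 < W by apply: pow_lt; lra.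
have HKL : 0 <= 8 / (1 - alpha) * L ^ 5 by apply: Rmult_le_pos; lra.
have Hl1 : 1312 * L ^ 4 <= W by lra.
have Hl2 : 8 * L ^ 5 * W <= (1 - alpha) * W ^ 2.
  have H : 8 / (1 - alpha) * L ^ 5 <= W by lra.
  have -> : 8 * L ^ 5 * W = (1 - alpha) * (8 / (1 - alpha) * L ^ 5 * W) by field; lra.
  rewrite (_ : W ^ 2 = W * W); last by ring.
  apply: Rmult_le_compat_l; [lra | apply: Rmult_le_compat_r; lra].
have [P HP] : exists P, INR P = 2 * W ^ 2.
  exists (2 * Nat.pow (Nat.pow 4 nu) 2)%coq_nat.
  by rewrite mult_INR !pow_INR /W (INR_IZR_INZ 4) (INR_IZR_INZ 2).
pose good j : bool := if excluded_middle_informative (zero_free_index zeta (63 / 64) 4 nu (Z.of_nat j))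
  then true else false.
have goodP : forall j, good j <-> zero_free_index zeta (63 / 64) 4 nu (Z.of_nat j).
  by move=> j; rewrite /good; case: excluded_middle_informative.
have Hrange : forall j, j \in iota 1 P -> (0 < j)%N /\ INR j <= 2 * W ^ 2.
  move=> j; rewrite mem_iota add1n ltnS => /andP [Hj HjP]; split=> //.
  by rewrite -HP; apply: le_INR; apply/leP.
have Hbad : forall b, INR (size [seq j <- iota 1 P | ~~ good j & odd j == b]) <= (1 - alpha) * W ^ 2.
  move=> b; apply: Rle_trans Hl2.
  apply: (bad_indices_count zeta nu _ b) => //; first by rewrite filter_uniq // iota_uniq.
  move=> j; rewrite mem_filter => /andP [/andP [Hg /eqP Ho] Hj].
  have [H1 H2] := Hrange j Hj; do 3!split=> //.
  by move=> /goodP H; rewrite H in Hg.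
exists (List.map Z.of_nat [seq j <- iota 1 P | good j]); split.
  by apply: NoDup_map_of_nat; rewrite filter_uniq // iota_uniq.
split.
  move=> z /List.in_map_iff [j [<- /In_mem]]; rewrite mem_filter => /andP [/goodP Hg /Hrange [H1 H2]].
  split; first by have := elimT ltP H1; lia.
  by split=> //; rewrite -INR_IZR_INZ.
rewrite List.length_map.
(* Every index is good, bad and odd, or bad and even; the good ones number at least 2 W^2 - 2 (1 -
   alpha) W^2. *)
have Hcount : size (iota 1 P) = (size [seq j <- iota 1 P | good j]
    + (size [seq j <- iota 1 P | ~~ good j & odd j == true] + size [seq j <- iota 1 P | ~~ good j & odd j == false]))%N.
  elim: (iota 1 P) => //= j l ->.
  by case: (good j); case: (odd j) => /=; rewrite ?addSn ?addnS.
have := f_equal INR Hcount; rewrite size_iota HP !plus_INR.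
have -> : forall l : seq nat, length l = size l by elim=> //= j l ->.
have := Hbad true; have := Hbad false; lra.
Qed.

End ZeroDensity.

Theorem theorem1p1 (zeta : C -> C) (Hzeta : is_riemann_zeta zeta)
    (alpha : R) (Halpha : 0 < alpha < 1) :
  exists sigma0 B nu0 : R,
    1 / 2 < sigma0 < 1 /\ 4 <= B /\
    forall nu : nat, (1 <= nu)%nat -> nu0 <= INR nu ->
      at_least (alpha * two_Rpower (B * INR nu + 1))
        (fun j : Z =>
           (1 <= j)%Z /\ IZR j <= two_Rpower (B * INR nu + 1) /\
           zero_free_index zeta sigma0 B nu j).
Proof. exact: ZeroDensity.zero_free_indices. Qed.
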